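(* Let $X$ be an infinite-dimensional complex Banach space, $\lambda\in\mathbb{C}$, $T\in L(X)$, $d\in\mathbb{N}_0$, and let $T-\lambda I$ have TUD for $n\ge d$. Then the following statements are equivalent: (1) $\sigma_{\mathcal{W}_-}(T)$ does not cluster at $\lambda$; (2) $\lambda$ is not an interior point of $\sigma_{\mathcal{W}_-}(T)$; (3) $\sigma_{B\mathcal{W}_-}(T)$ does not cluster at $\lambda$; (4) $\lambda$ is not an interior point of $\sigma_{B\mathcal{W}_-}(T)$. In particular, if $T-\lambda I$ is quasi-Fredholm, then the statements (1)-(4) are equivalent to the following statement: (5) $T-\lambda I$ is a lower semi-B-Weyl operator.
   Context: $L(X)$ is the algebra of bounded linear operators on $X$; $N(T)$, $R(T)$ are the null space and range; $\alpha(T)=\dim N(T)$, $\beta(T)=\operatorname{codim}R(T)$; $\mathbb{N}_0=\{0,1,2,\dots\}$. An operator $S$ on a complex Banach space is lower semi-Fredholm if $\beta(S)<\infty$; its index is $\operatorname{ind}(S)=\alpha(S)-\beta(S)$; it is lower semi-Weyl if moreover $\operatorname{ind}(S)\ge0$. $\sigma_{\mathcal{W}_-}(T)$ is the set of $\mu\in\mathbb{C}$ such that $T-\mu I$ is not lower semi-Weyl. For $n\in\mathbb{N}_0$ let $T_n$ be the restriction of $T$ to $R(T^n)$ as a map $R(T^n)\to R(T^n)$. $T$ is lower semi-B-Fredholm if for some $n\in\mathbb{N}_0$, $R(T^n)$ is closed and $T_n$ is lower semi-Fredholm; then $\operatorname{ind}(T):=\operatorname{ind}(T_n)$, which is independent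 of the choice of such $n$. $T$ is lower semi-B-Weyl if it is lower semi-B-Fredholm and $\operatorname{ind}(T)\ge 0$. $\sigma_{B\mathcal{W}_-}(T)$ is the set of $\mu\in\mathbb{C}$ such that $T-\mu I$ is not lower semi-B-Weyl. Let $k_n(T)=\dim (R(T^n)\cap N(T))/(R(T^{n+1})\cap N(T))$. $T$ is quasi-Fredholm if there is $m\in\mathbb{N}_0$ such that $k_n(T)=0$ for all $n\ge m$ and $R(T^{m+1})$ is closed. The operator range topology on $R(T^d)$ is given by the norm $\|y\|_d=\inf\{\|x\|:x\in X,\ y=T^dx\}$. $T$ has topological uniform descent (TUD) for $n\ge d$ if $k_n(T)=0$ for all $n\ge d$ and $R(T^n)$ is closed in the operator range topology of $R(T^d)$ for all $n\ge d$. A set $K\subset\mathbb{C}$ does not cluster at $\lambda$ if $\lambda$ is not an accumulation point of $K$; interior is taken in $\mathbb{C}$. *)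

(* Defs.v *)
From HB Require Import structures.
From mathcomp Require Import all_boot all_order all_algebra.
From mathcomp Require Import complex.
From mathcomp Require Import all_classical all_reals all_analysis.

Set Implicit Arguments.
Unset Strict Implicit.
Unset Printing Implicit Defensive.

Import Order.TTheory GRing.Theory Num.Theory.
Import numFieldNormedType.Exports.

Local Open Scope classical_set_scope.
Local Open Scope ring_scope.
Local Open Scope complex_scope.

Section Dimension.
Context {R : realType} {X : lmodType R[i]}.
Implicit Types (V W : set X) (T : {linear X -> X}).

Definition free_mod W n (v : 'I_n -> X) : Prop :=
  forall c : 'I_n -> R[i], W (\sum_(i < n) c i *: v i) -> forall i, c i = 0.

(* dim (V / W) for linear subspaces W `<=` V, as the supremum of the sizes of
   the finite families of V that are linearly independent modulo W. The family
   of size 0 always qualifies, so the value is a natural number or +oo. *)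
Definition quotdim V W : \bar R :=
  ereal_sup [set n%:R%:E | n in
    [set n | exists v : 'I_n -> X, (forall i, V (v i)) /\ free_mod W v]].

Definition subdim V : \bar R := quotdim V [set 0].

(* If T maps the subspace V into itself, restr_ker T V and T @` V are the null
   space and the range of the restriction V -> V of T; the notions below are
   those of this restriction, and V = setT gives those of T itself. *)
Definition restr_ker T V : set X := V `&` [set x | T x = 0].

Definition nullity T V : \bar R := subdim (restr_ker T V).

Definition defect T V : \bar R := quotdim V (T @` V).

(* Only meaningful when defect T V is finite (the other cases of the subtraction
   of extended reals are conventional). *)
Definition fredholm_index T V : \bar R := (nullity T V - defect T V)%E.

Definition lower_semi_fredholm T V : Prop := (defect T V < +oo)%E.

Definition lower_semi_weyl T V : Prop :=
  lower_semi_fredholm T V /\ (0 <= fredholm_index T V)%E.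

Definition range_iter T n : set X := range (iter n T).

Definition k_ T n : \bar R :=
  quotdim (restr_ker T (range_iter T n)) (restr_ker T (range_iter T n.+1)).

Definition sub_scalar T (mu : R[i]) : {linear X -> X} := T \- mu \*: idfun.

Definition lower_semi_weyl_spectrum T : set R[i]^o :=
  [set mu | ~ lower_semi_weyl (sub_scalar T mu) setT].

End Dimension.

Section Operators.
Context {R : realType} {X : normedModType R[i]}.
Implicit Types (T : {linear X -> X}).

Definition b_fredholm_degree T n : Prop :=
  closed (range_iter T n) /\ lower_semi_fredholm T (range_iter T n).

Definition lower_semi_b_fredholm T : Prop := exists n, b_fredholm_degree T n.

(* The common value of the indices of the restrictions of T to its closed
   ranges range_iter T n of lower semi-Fredholm type; 0 if there are none. *)
Definition b_index T : \bar R :=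
  xget 0%E [set fredholm_index T (range_iter T n) | n in b_fredholm_degree T].

Definition lower_semi_b_weyl T : Prop :=
  lower_semi_b_fredholm T /\ (0 <= b_index T)%E.

Definition lower_semi_b_weyl_spectrum T : set R[i]^o :=
  [set mu | ~ lower_semi_b_weyl (sub_scalar T mu)].

Definition quasi_fredholm T : Prop :=
  exists m, (forall n, (m <= n)%N -> k_ T n = 0%E) /\
            closed (range_iter T m.+1).

(* The norm of X takes (real) values in R[i], hence the real part. *)
Definition range_norm T d (y : X) : R :=
  inf [set complex.Re `|x| | x in [set x | y = iter d T x]].

Definition range_closed T d (A : set X) : Prop :=
  forall y, range_iter T d y ->
    (forall e : R, 0 < e -> exists2 z, A z & range_norm T d (y - z) < e) ->
    A y.

Definition top_uniform_descent T d : Prop :=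
  (forall n, (d <= n)%N -> k_ T n = 0%E) /\
  (forall n, (d <= n)%N -> range_closed T d (range_iter T n)).

End Operators.

(* Main.v *)
Require Import Defs.
From HB Require Import structures.
From mathcomp Require Import all_boot all_order all_algebra.
From mathcomp Require Import complex ring lra zify.
From mathcomp Require Import all_classical all_reals all_analysis.

Set Implicit Arguments.
Unset Strict Implicit.
Unset Printing Implicit Defensive.

Import Order.TTheory GRing.Theory Num.Theory.
Import numFieldNormedType.Exports.

Local Open Scope classical_set_scope.
Local Open Scope ring_scope.
Local Open Scope complex_scope.

(** Put S = T - lambda I and K = N(S^d), and attach to every scalar nu the
subspaces P(nu) = R(S - nu) + K and V(nu) = {x | (S - nu) x is in K} of X.
They are the preimages in X of the range and of the null space of the operator
that S - nu induces on X/K. As S^d identifies X/K with R(S^d) in its range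
norm, this operator is the restriction of S - nu to the Banach space R(S^d),
and working modulo K in X makes that space and its norm unnecessary. Both
uniform descent and quasi-Fredholmness give the same two facts: k_n(S) = 0
for n >= d, and P(0) is closed in X ([range_closed_shift_range],
[closed_shift_range]); in the quasi-Fredholm case, d is the degree that this
hypothesis provides.

For nu <> 0 the operator S - nu is invertible on K, so that codim P(nu) and
dim V(nu)/K are the defect and the nullity of S - nu on X; for nu = 0 they are
the defect and the nullity of the restriction of S to R(S^d) ([defect_shift],
[nullity_shift], [defect_shift0], [nullity_shift0]). The theorem thus rests on
the fact that these two dimensions, finite or not, are constant on a disc
around 0 ([quotdim_shift_range], [quotdim_shift_ker]), which is a form of the
punctured neighbourhood theorem of Grabiner.

To prove it, the open mapping theorem gives a constant c such that every y of
P(0) is S x modulo K with |x| <= c |y|. As k_n = 0 for n >= d, the vectors of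
V(0) have preimages of every order, and a power series in nu turns them into
nearby vectors of V(nu) ([shift_ker0_close]). This makes the lifting constant
uniform on a disc ([shift_lifts_uniform]). With it, P(nu) and P(mu), and
likewise V(nu) and V(mu), are close to each other when nu - mu is small. Close
subspaces have the same dimensions, because suitable families of n vectors,
chosen as in the Riesz lemma, survive small changes of the subspaces
([gap_lemma], [codim_gap_lemma]). The admissible distance depends on n but not
on the place in the disc, so finitely many steps connect any two points of the
disc ([disc_chain]). As n is fixed along the way, this settles finite and
infinite dimensions together.

The same closeness shows that S - nu is semi-regular for small nu <> 0: its
kernel lies in the range of each of its powers ([shift_semi_regular]). Then all
restrictions of S - nu to the ranges of its powers have the same nullity and
the same defect, and lower semi-B-Weyl means lower semi-Weyl. Hence on a
punctured disc around lambda both properties of T - mu are equivalent to one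
condition independent of mu: the restriction of S to R(S^d) is lower semi-Weyl
([punctured_disc]). Moreover the index of the restriction of an operator to
R(T^n) does not change with n once the defect is finite ([index_step]), and
beyond d the defect does not change either, so this condition also follows if S
itself is lower semi-Weyl or lower semi-B-Weyl.
Accumulation and interiority at lambda are then decided by that condition
([limit_point_interior]), and if R(S^(d+1)) is closed in X the condition says
that S is lower semi-B-Weyl. *)

(** * Dimensions of quotients *)
Section QuotientDimension.
Context {R : realType} {X : lmodType R[i]}.
Implicit Types (V W U : set X) (n : nat).

Definition linsubspace V : Prop :=
  V 0 /\ forall (a : R[i]) x y, V x -> V y -> V (a *: x + y).

Lemma linsubspaceD V x y : linsubspace V -> V x -> V y -> V (x + y).
Proof. by move=> [_ VD] Vx Vy; rewrite -[x]scale1r; exact: VD. Qed.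

Lemma linsubspaceZ V a x : linsubspace V -> V x -> V (a *: x).
Proof. by move=> [V0 VD] Vx; rewrite -[_ *: _]addr0; exact: VD. Qed.

Lemma linsubspaceN V x : linsubspace V -> V x -> V (- x).
Proof. by move=> sV Vx; rewrite -scaleN1r; exact: linsubspaceZ. Qed.

Lemma linsubspaceB V x y : linsubspace V -> V x -> V y -> V (x - y).
Proof. by move=> sV Vx Vy; apply: linsubspaceD => //; exact: linsubspaceN. Qed.

Lemma linsubspace_sum V (I : Type) (r : seq I) (c : I -> R[i]) (v : I -> X) :
  linsubspace V -> (forall i, V (v i)) -> V (\sum_(i <- r) c i *: v i).
Proof.
move=> sV Vv; elim/big_rec: _ => [|i x _ Vx]; first by case: sV.
by apply: linsubspaceD => //; exact: linsubspaceZ.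
Qed.

Lemma linsubspace_setT : linsubspace setT.
Proof. by []. Qed.

Lemma linsubspace_set0 : linsubspace [set 0].
Proof. by split=> //= a x y -> ->; rewrite scaler0 addr0. Qed.

(** Dimensions are compared through these families only: two values of
[quotdim], finite or infinite, agree as soon as the same sizes n occur. *)
Definition has_free V W n : Prop :=
  exists v : 'I_n -> X, (forall i, V (v i)) /\ free_mod W v.

Lemma has_free0 V W : has_free V W 0.
Proof. by exists (fun=> 0); split => [[]//|c _ []]. Qed.

Lemma has_free_leq V W m n : (m <= n)%N -> has_free V W n -> has_free V W m.
Proof.
move=> mn [v [Vv fv]]; exists (fun i => v (widen_ord mn i)); split=> // c Wc i.
pose c' (j : 'I_n) := if insub (val j) is Some k then c k else 0.
have c'E k : c' (widen_ord mn k) = c k by rewrite /c' valK.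
rewrite -c'E; apply: fv; congr W: Wc.
rewrite (bigID (fun j : 'I_n => j < m)%N) /= [X in _ + X]big1 ?addr0; last first.
  by move=> j jm; rewrite /c' insubF ?scale0r//; apply/negbTE.
rewrite (big_ord_narrow mn).
by apply: eq_bigr => k _; rewrite c'E.
Qed.

Lemma quotdim_geP V W n : (n%:R%:E <= quotdim V W)%E <-> has_free V W n.
Proof.
split; last by move=> fn; apply: ereal_sup_ubound; exists n.
case: n => [_|n]; first exact: has_free0.
apply: contraPP => nfree; apply/negP; rewrite -ltNge.
have : (quotdim V W <= n%:R%:E)%E.
  apply: ge_ereal_sup => _ [m fm <-]; rewrite lee_fin ler_nat leqNgt.
  by apply/negP => nm; apply: nfree; exact: has_free_leq fm.
by move=> /le_lt_trans; apply; rewrite lte_fin ltr_nat.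
Qed.

Lemma quotdim_le V W V' W' :
  (forall n, has_free V W n -> has_free V' W' n) ->
  (quotdim V W <= quotdim V' W')%E.
Proof. by move=> h; apply: le_ereal_sup => _ [n fn <-]; exists n => //; exact: h. Qed.

Lemma quotdim_ge0 V W : (0 <= quotdim V W)%E.
Proof. by apply/(quotdim_geP V W 0); exact: has_free0. Qed.

Lemma quotdim_eq V W n :
  has_free V W n -> ~ has_free V W n.+1 -> quotdim V W = n%:R%:E.
Proof.
move=> fn nfn; apply/le_anti/andP; split; last exact/quotdim_geP.
apply: ge_ereal_sup => _ [m fm <-]; rewrite lee_fin ler_nat leqNgt.
by apply/negP => nm; apply: nfn; exact: has_free_leq fm.
Qed.

Lemma quotdimP V W :
  (quotdim V W = +oo%E /\ forall n, has_free V W n) \/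
  exists n, [/\ quotdim V W = n%:R%:E, has_free V W n & ~ has_free V W n.+1].
Proof.
have [fn|/existsNP[n nfn]] := pselect (forall n, has_free V W n); [left|right].
  split=> //; apply/eqyP => r r0; apply: (@le_trans _ _ (Num.trunc r).+1%:R%:E); last first.
    by apply/quotdim_geP; exact: fn.
  by rewrite lee_fin ltW// truncnS_gt.
elim: n nfn => [|n ih] nfn; first by case: nfn; exact: has_free0.
have [fn|/ih//] := pselect (has_free V W n).
by exists n; split=> //; exact: quotdim_eq.
Qed.

Lemma quotdim_eq0 V W x :
  linsubspace W -> quotdim V W = 0%E -> V x -> W x.
Proof.
move=> sW VW0 Vx; apply: contrapT => Wx.
have : has_free V W 1.
  exists (fun=> x); split=> // c; rewrite big_ord1 => Wcx i; rewrite ord1.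
  apply: contrapT => /eqP c0; apply: Wx.
  by rewrite -[x](scalerK c0); exact: linsubspaceZ.
by move=> /quotdim_geP; rewrite VW0 lee_fin ler10.
Qed.

(** A dependence between x and a maximal free family must involve x, since the
family is free; solving it for x expresses x by the family modulo W. *)
Lemma maximal_free_span V W n (v : 'I_n -> X) :
    linsubspace W -> free_mod W v -> (forall i, V (v i)) -> ~ has_free V W n.+1 ->
  forall x, V x -> exists c : 'I_n -> R[i], W (x - \sum_i c i *: v i).
Proof.
move=> sW fv Vv nf x Vx; apply: contrapT => ncomb; apply: nf.
exists (fun i => oapp v x (unlift ord0 i)); split => [i|c].
  by case: unliftP => [j _|_] /=.
rewrite big_ord_recl unlift_none /= => Wc.
have {}Wc : W (c ord0 *: x + \sum_(i < n) c (lift ord0 i) *: v i).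
  congr (W (_ + _)): Wc.
  by apply: eq_bigr => j _; rewrite liftK.
have c0 : c ord0 = 0.
  apply: contrapT => /eqP c0; apply: ncomb.
  exists (fun i => - ((c ord0)^-1 * c (lift ord0 i))).
  have := linsubspaceZ (c ord0)^-1 sW Wc.
  rewrite scalerDr scalerA mulVf// scale1r scaler_sumr.
  congr (W (_ + _)); rewrite -sumrN; apply: eq_bigr => i _.
  by rewrite scaleNr opprK scalerA.
move=> i; case: (unliftP ord0 i) => [j ->|->//].
apply: (fv (fun j => c (lift ord0 j))).
by move: Wc; rewrite c0 scale0r add0r.
Qed.

(** Steinitz: the coefficients of more than m vectors on m generators form a
matrix with a nonzero left kernel, which is a dependence modulo W. *)
Lemma free_leq_span V W m n (g : 'I_m -> X) : linsubspace W ->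
  (forall x, V x -> exists c : 'I_m -> R[i], W (x - \sum_i c i *: g i)) ->
  has_free V W n -> (n <= m)%N.
Proof.
move=> sW Vg [v [Vv fv]]; rewrite leqNgt; apply/negP => mn.
have /choice[M WM] : forall i, exists c : 'I_m -> R[i],
  W (v i - \sum_j c j *: g j) by move=> i; exact: Vg.
pose A : 'M[R[i]]_(n, m) := \matrix_(i, j) M i j.
have : kermx A != 0.
  rewrite kermx_eq0 -row_leq_rank -ltnNge.
  exact: leq_ltn_trans (rank_leq_col A) mn.
move=> /rowV0Pn[c /sub_kermxP cA /rV0Pn[i /eqP]]; apply.
apply: (fv (fun i => c 0 i)).
have := linsubspace_sum (index_enum 'I_n) (c 0) sW WM; congr W.
under eq_bigr do rewrite scalerBr.
rewrite sumrB; apply/eqP; rewrite subr_eq -{1}[\sum_i _]addr0; apply/eqP.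
congr (_ + _); symmetry.
under eq_bigr do rewrite scaler_sumr.
rewrite exchange_big /= big1// => j _.
transitivity ((c *m A) 0 j *: g j); last by rewrite cA mxE scale0r.
rewrite mxE scaler_suml; apply: eq_bigr => k _.
by rewrite !mxE scalerA.
Qed.

Definition cat_fam (A : Type) a b (f : 'I_a -> A) (g : 'I_b -> A) i : A :=
  match fintype.split i with inl j => f j | inr j => g j end.

Lemma cat_faml (A : Type) a b (f : 'I_a -> A) (g : 'I_b -> A) i :
  cat_fam f g (lshift b i) = f i.
Proof. by rewrite /cat_fam (unsplitK (inl i)). Qed.

Lemma cat_famr (A : Type) a b (f : 'I_a -> A) (g : 'I_b -> A) i :
  cat_fam f g (rshift a i) = g i.
Proof. by rewrite /cat_fam (unsplitK (inr i)). Qed.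

Lemma cat_fam_sum a b (c : 'I_(a + b) -> R[i]) (v : 'I_a -> X) (u : 'I_b -> X) :
  \sum_i c i *: cat_fam v u i =
  \sum_i c (lshift b i) *: v i + \sum_i c (rshift a i) *: u i.
Proof.
rewrite big_split_ord /=; congr (_ + _); apply: eq_bigr => i _.
  by rewrite cat_faml.
by rewrite cat_famr.
Qed.

Lemma has_freeD V U W a b : W `<=` U -> U `<=` V -> linsubspace U ->
  has_free V U a -> has_free U W b -> has_free V W (a + b).
Proof.
move=> WU UV sU [v [Vv fv]] [u [Uu fu]].
exists (cat_fam v u); split=> [i|c].
  by rewrite /cat_fam; case: fintype.split => j //; exact/UV.
rewrite cat_fam_sum => Wc.
have ca i : c (lshift b i) = 0.
  apply: (fv (fun i => c (lshift b i))).
  rewrite -[\sum_i _](addrK (\sum_(i < b) c (rshift a i) *: u i)).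
  by apply: linsubspaceB => //; [exact: WU|exact: linsubspace_sum].
have cb i : c (rshift a i) = 0.
  apply: (fu (fun i => c (rshift a i))); move: Wc.
  by rewrite big1 ?add0r// => j _; rewrite ca scale0r.
by move=> i; rewrite -(splitK i); case: fintype.split => j /=.
Qed.

Lemma quotdimD V U W : W `<=` U -> U `<=` V -> linsubspace U -> linsubspace W ->
  quotdim V W = (quotdim V U + quotdim U W)%E.
Proof.
move=> WU UV sU sW.
have [[-> fa]|[a [-> fa nfa]]] := quotdimP V U.
  rewrite addye ?gt_eqF ?(lt_le_trans _ (quotdim_ge0 _ _))//.
  have [[]//|[n [_ _ []]]] := quotdimP V W.
  by rewrite -[n.+1]addn0; apply: has_freeD (fa _) (has_free0 _ _).
have [[-> fb]|[b [-> fb nfb]]] := quotdimP U W.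
  rewrite addey//; have [[]//|[n [_ _ []]]] := quotdimP V W.
  by rewrite -[n.+1]add0n; apply: has_freeD (has_free0 _ _) (fb _).
rewrite -EFinD -natrD; apply: quotdim_eq; first exact: has_freeD fa fb.
case: fa fb => v [Vv fv] [u [Uu fu]].
move=> fab; suff : ((a + b).+1 <= a + b)%N by rewrite ltnn.
apply: (@free_leq_span V W _ _ (cat_fam v u) sW) fab => x Vx.
have [c Uc] := maximal_free_span sU fv Vv nfa Vx.
have [e We] := maximal_free_span sW fu Uu nfb Uc.
exists (cat_fam c e); rewrite cat_fam_sum opprD addrA.
congr (W (_ - _ - _)): We; apply: eq_bigr => i _.
  by rewrite cat_faml.
by rewrite cat_famr.
Qed.

(** Transfer along a linear relation. Taking for the relation the graph of a
linear map, its converse, or congruence modulo a subspace makes this cover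
images, lifts and the second isomorphism theorem at once. *)
Lemma has_free_rel (rho : X -> X -> Prop) V W V' W' n :
    rho 0 0 ->
    (forall (a : R[i]) x y x' y', rho x y -> rho x' y' ->
       rho (a *: x + x') (a *: y + y')) ->
    linsubspace V ->
    (forall x, V x -> exists2 y, V' y & rho x y) ->
    (forall x y, V x -> rho x y -> W' y -> W x) ->
  has_free V W n -> has_free V' W' n.
Proof.
move=> rho0 rhoD sV VV' WW' [v [Vv fv]].
have /choice[u uP] : forall i, exists y, V' y /\ rho (v i) y.
  by move=> i; have [y] := VV' _ (Vv i); exists y.
exists u; split => [i|c Wc]; first by have [] := uP i.
apply: fv; apply: WW' Wc; first exact: linsubspace_sum.
elim/big_rec2: _ => // i x y _ rxy.
by apply: rhoD => //; have [] := uP i.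
Qed.

Lemma quotdim_rel (rho : X -> X -> Prop) V W V' W' :
    rho 0 0 ->
    (forall (a : R[i]) x y x' y', rho x y -> rho x' y' ->
       rho (a *: x + x') (a *: y + y')) ->
    linsubspace V -> linsubspace V' ->
    (forall x, V x -> exists2 y, V' y & rho x y) ->
    (forall y, V' y -> exists2 x, V x & rho x y) ->
    (forall x y, V x -> V' y -> rho x y -> (W x <-> W' y)) ->
  quotdim V W = quotdim V' W'.
Proof.
move=> rho0 rhoD sV sV' VV' V'V WW'; apply/le_anti/andP; split.
  apply: quotdim_le => n [v [Vv fv]].
  apply: (@has_free_rel (fun x y => rho x y /\ V' y) V W V' W') => //.
  - by case: sV'.
  - by move=> a x y x' y' [r Vy] [r' Vy']; split; [exact: rhoD|case: sV' => _; exact].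
  - by move=> x /VV'[y]; exists y.
  - by move=> x y Vx [r Vy] /(WW' _ _ Vx Vy r).
  - by exists v.
apply: quotdim_le => n [v [Vv fv]].
apply: (@has_free_rel (fun x y => rho y x /\ V y) V' W' V W) => //.
- by case: sV.
- by move=> a x y x' y' [r Vy] [r' Vy']; split; [exact: rhoD|case: sV => _; exact].
- by move=> x /V'V[y]; exists y.
- by move=> x y Vx [r Vy] /(WW' _ _ Vy Vx r).
- by exists v.
Qed.

End QuotientDimension.

(** * Ranges of iterates and constancy of the index *)
Section Iterates.
Context {R : realType} {X : lmodType R[i]}.
Implicit Types (T : {linear X -> X}) (m n : nat).

Lemma sub_scalarE T mu x : sub_scalar T mu x = T x - mu *: x.
Proof. by []. Qed.

Lemma iter_linearP T n (a : R[i]) x y :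
  iter n T (a *: x + y) = a *: iter n T x + iter n T y.
Proof. by elim: n => //= n ->; rewrite linearP. Qed.

Lemma iter_linear0 T n : iter n T 0 = 0.
Proof. by elim: n => //= n ->; rewrite linear0. Qed.

Lemma iter_linearZ T n (a : R[i]) x : iter n T (a *: x) = a *: iter n T x.
Proof. by rewrite -[a *: x]addr0 iter_linearP iter_linear0 addr0. Qed.

Lemma iter_linearD T n x y : iter n T (x + y) = iter n T x + iter n T y.
Proof. by rewrite -[x]scale1r iter_linearP !scale1r. Qed.

Lemma iter_linearB T n x y : iter n T (x - y) = iter n T x - iter n T y.
Proof. by rewrite iter_linearD -scaleN1r iter_linearZ scaleN1r. Qed.

Lemma linsubspace_range_iter T n : linsubspace (range_iter T n).
Proof.
split; first by exists 0 => //; rewrite iter_linear0.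
move=> a _ _ [x _ <-] [y _ <-]; exists (a *: x + y) => //.
exact: iter_linearP.
Qed.

Lemma linsubspace_restr_ker T (V : set X) : linsubspace V -> linsubspace (restr_ker T V).
Proof.
move=> [V0 VD]; split; first by split=> //=; rewrite linear0.
move=> a x y [Vx Tx] [Vy Ty]; split; first exact: VD.
by move: Tx Ty => /= Tx Ty; rewrite linearP Tx Ty scaler0 addr0.
Qed.

Lemma range_iterS T n : range_iter T n.+1 = T @` range_iter T n.
Proof.
apply/seteqP; split => [_ [x _ <-]|_ [_ [x _ <-] <-]].
  by exists (iter n T x) => //; exists x.
by exists x.
Qed.

Lemma range_iter0 T : range_iter T 0 = setT.
Proof. by apply/seteqP; split => // x _; exists x. Qed.

Lemma range_iter_subS T n : range_iter T n.+1 `<=` range_iter T n.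
Proof. by move=> _ [x _ <-]; exists (T x) => //; rewrite -iterSr. Qed.

(** This and [defect_step] lose the same summand k_n, which is why the index
does not depend on n. *)
Lemma nullity_step T n :
  nullity T (range_iter T n) = (k_ T n + nullity T (range_iter T n.+1))%E.
Proof.
apply: quotdimD.
- move=> _ ->; split; last by rewrite /= linear0.
  by have [] := linsubspace_range_iter T n.+1.
- by move=> x [/range_iter_subS Rx].
- exact/linsubspace_restr_ker/linsubspace_range_iter.
- exact: linsubspace_set0.
Qed.

(** T maps R(T^n) onto R(T^(n+1)) and induces a surjection from
R(T^n)/R(T^(n+1)) to R(T^(n+1))/R(T^(n+2)). The subspace U below, which is
R(T^(n+1)) + (N(T) meet R(T^n)), is its kernel before passing to the quotient,
and U/R(T^(n+1)) has dimension k_n. *)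
Lemma defect_step T n :
  defect T (range_iter T n) = (defect T (range_iter T n.+1) + k_ T n)%E.
Proof.
pose U := [set x | exists2 z, restr_ker T (range_iter T n) z &
                   range_iter T n.+1 (x - z)].
have sR := linsubspace_range_iter T.
have [K0 KD] := linsubspace_restr_ker T (sR n).
have sU : linsubspace U.
  split; first by exists 0 => //; rewrite subr0; case: (sR n.+1).
  move=> a x y [z Kz Rz] [t Kt Rt]; exists (a *: z + t); first exact: KD.
  have -> : a *: x + y - (a *: z + t) = a *: (x - z) + (y - t).
    by rewrite scalerBr opprD addrACA.
  by case: (sR n.+1) => _; exact.
rewrite /defect -!range_iterS (@quotdimD _ _ _ U); last 1 first.
- exact: sR.
- congr (_ + _)%E.
  + apply: (@quotdim_rel _ _ (fun x y => T x = y)) => //.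
    * exact: linear0.
    * by move=> a x _ x' _ <- <-; rewrite linearP.
    * by move=> x Rx; exists (T x) => //; rewrite range_iterS; exists x.
    * by move=> y; rewrite range_iterS => -[x Rx <-]; exists x.
    * move=> x _ Rx _ <-; split=> [[z [Rz Tz] Rxz]|].
        rewrite range_iterS; exists (x - z) => //.
        by rewrite linearB /= Tz subr0.
      rewrite range_iterS => -[w Rw Tw].
      exists (x - w); last by rewrite opprB addrC subrK.
      split; last by rewrite /= linearB Tw subrr.
      by apply: linsubspaceB => //; exact: range_iter_subS.
  + apply: (@quotdim_rel _ _ (fun x y => range_iter T n.+1 (x - y))) => //.
    * by rewrite subr0; case: (sR n.+1).
    * move=> a x y x' y' Rxy Rxy'.
      have -> : a *: x + x' - (a *: y + y') = a *: (x - y) + (x' - y').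
        by rewrite scalerBr opprD addrACA.
      by case: (sR n.+1) => _; exact.
    * move=> y Ky; exists y; last by rewrite subrr; case: (sR n.+1).
      by exists y => //; rewrite subrr; case: (sR n.+1).
    * move=> x y _ [Ry Ty] Rxy; split=> [Rx|[Ry1 _]].
        split=> //; have -> : y = x - (x - y) by rewrite opprB addrC subrK.
        exact: linsubspaceB.
      by rewrite -(subrK y x); exact: linsubspaceD.
- by move=> x Rx; exists 0 => //; rewrite subr0.
- move=> x [z [Rz _] Rxz]; rewrite -(subrK z x); apply: linsubspaceD => //.
  exact: range_iter_subS.
- exact: sU.
Qed.

Lemma defect_leS T n :
  (defect T (range_iter T n.+1) <= defect T (range_iter T n))%E.
Proof. by rewrite [leRHS]defect_step leeDl// quotdim_ge0. Qed.

Lemma defect_le T m n : (m <= n)%N ->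
  (defect T (range_iter T n) <= defect T (range_iter T m))%E.
Proof.
move=> /subnKC <-; elim: (n - m)%N => [|k ih]; first by rewrite addn0.
by rewrite addnS; exact: le_trans (defect_leS T _) ih.
Qed.

Lemma fin_num_quotdim (V W : set X) :
  (quotdim V W < +oo)%E -> quotdim V W \is a fin_num.
Proof. by move=> h; rewrite ge0_fin_numE// quotdim_ge0. Qed.

Lemma index_step T n : (defect T (range_iter T n) < +oo)%E ->
  fredholm_index T (range_iter T n) = fredholm_index T (range_iter T n.+1).
Proof.
move=> fd; have fd1 := le_lt_trans (defect_leS T n) fd.
have fk : (k_ T n < +oo)%E.
  by apply: le_lt_trans fd; rewrite [leRHS]defect_step leeDr// quotdim_ge0.
rewrite /fredholm_index nullity_step defect_step.
move: fk fd1 => /fin_num_quotdim; rewrite -/(k_ T n) => /fineK <-.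
move=> /fin_num_quotdim; rewrite -/(defect _ _) => /fineK <-.
case: (nullity _ _) (quotdim_ge0 (restr_ker T (range_iter T n.+1)) [set 0]) => [a| |]//= _.
by rewrite -!EFinD; congr EFin; ring.
Qed.
End Iterates.

(** * Range and kernel of S - nu modulo N(S^d) *)
Section ShiftedOperators.
Context {R : realType} {X : lmodType R[i]}.
Variables (S : {linear X -> X}) (d : nat).
Implicit Types (nu mu : R[i]).

Definition ker_iter : set X := [set x | iter d S x = 0].

Definition shift_range nu : set X :=
  [set y | exists x, ker_iter (y - sub_scalar S nu x)].

Definition shift_ker nu : set X := [set x | ker_iter (sub_scalar S nu x)].

Lemma linsubspace_ker_iter : linsubspace ker_iter.
Proof.
split; first exact: iter_linear0.
by rewrite /ker_iter => a x y /= Kx Ky; rewrite iter_linearP Kx Ky scaler0 addr0.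
Qed.

Let sK := linsubspace_ker_iter.

Lemma ker_iter_stable nu x : ker_iter x -> ker_iter (sub_scalar S nu x).
Proof.
move=> Kx; rewrite sub_scalarE; apply: linsubspaceB => //.
  by rewrite /ker_iter /= -iterSr /= Kx linear0.
exact: linsubspaceZ.
Qed.

Lemma linsubspace_shift_range nu : linsubspace (shift_range nu).
Proof.
split; first by exists 0; rewrite linear0 subrr; case: sK.
move=> a x y [z Kz] [t Kt]; exists (a *: z + t).
rewrite linearP opprD addrACA -scalerBr.
by case: sK => _; exact.
Qed.

Lemma linsubspace_shift_ker nu : linsubspace (shift_ker nu).
Proof.
split; first by rewrite /shift_ker /mkset linear0; case: sK.
by move=> a x y Vx Vy; rewrite /shift_ker /mkset linearP; case: sK => _; exact.
Qed.

Lemma ker_iter_sub_shift_ker nu : ker_iter `<=` shift_ker nu.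
Proof. by move=> x; exact: ker_iter_stable. Qed.

Lemma ker_iter_sub_shift_range nu : ker_iter `<=` shift_range nu.
Proof. by move=> x Kx; exists 0; rewrite linear0 subr0. Qed.

Lemma sub_scalar_shift_range nu x : shift_range nu (sub_scalar S nu x).
Proof. by exists x; rewrite subrr; case: sK. Qed.

(** S is nilpotent on N(S^d), so S - nu is invertible there when nu <> 0. *)
Lemma ker_iter_lift nu k : nu != 0 -> ker_iter k ->
  exists2 k', ker_iter k' & sub_scalar S nu k' = k.
Proof.
move=> nu0; rewrite /ker_iter /mkset; elim: d k => [k|n ih k].
  move=> k0; have {k0} -> : k = 0 by []; by exists 0 => //; exact: linear0.
rewrite iterSr => /ih[k1 Kk1 Sk1]; exists (nu^-1 *: (k1 - k)).
  rewrite iter_linearZ iter_linearB [iter n.+1 S k]iterSr -Sk1 sub_scalarE.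
  rewrite iter_linearB iter_linearZ -iterSr /= Kk1 linear0 ?scaler0 ?subr0 ?scaler0 //.
have {Sk1} Sk : S k = S k1 - nu *: k1 by rewrite -Sk1.
rewrite sub_scalarE linearZ linearB /= Sk scalerA divff// scale1r.
by rewrite subKr scalerA mulVf// scale1r subKr.
Qed.

Lemma shift_range_image nu : nu != 0 -> sub_scalar S nu @` setT = shift_range nu.
Proof.
move=> nu0; apply/seteqP; split => [_ [x _ <-]|y [x Kx]].
  exact: sub_scalar_shift_range.
have [k' Kk' Sk'] := ker_iter_lift nu0 Kx.
by exists (k' + x) => //; rewrite linearD Sk' subrK.
Qed.

Lemma defect_shift nu : nu != 0 ->
  defect (sub_scalar S nu) setT = quotdim setT (shift_range nu).
Proof. by move=> nu0; rewrite /defect shift_range_image. Qed.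

(** V(nu) is the direct sum of N(S - nu) and K. The sum is direct because S^d
acts on N(S - nu) as multiplication by nu^d. *)
Lemma nullity_shift nu : nu != 0 ->
  nullity (sub_scalar S nu) setT = quotdim (shift_ker nu) ker_iter.
Proof.
move=> nu0.
apply: (@quotdim_rel _ _ (fun x y => ker_iter (x - y))).
- by rewrite subr0; case: sK.
- move=> a x y x' y' Kx Kx'; rewrite opprD addrACA -scalerBr.
  by case: sK => _; exact.
- exact: linsubspace_restr_ker linsubspace_setT.
- exact: linsubspace_shift_ker.
- move=> x [_ Sx]; exists x; last by rewrite subrr; case: sK.
  by rewrite /shift_ker /mkset (Sx : sub_scalar S nu x = 0); case: sK.
- move=> y Vy; have [k Kk Sk] := ker_iter_lift nu0 Vy.
  exists (y - k); last by rewrite addrAC subrr sub0r; exact: linsubspaceN.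
  by split=> //; rewrite /mkset linearB Sk subrr.
- move=> x y [_ Sx] Vy Kxy; split=> [/= x0|Ky].
    by move: Kxy; rewrite x0 sub0r => /(linsubspaceN sK); rewrite opprK.
  have Kx : ker_iter x by rewrite -(subrK y x); exact: linsubspaceD.
  have Sn n : iter n S x = nu ^+ n *: x.
    elim: n => [|n ih]; first by rewrite scale1r.
    rewrite /= ih linearZ /=; move: Sx => /= /eqP; rewrite subr_eq0 => /eqP ->.
    by rewrite scalerA exprSr.
  move: Kx; rewrite /ker_iter /= Sn => /eqP.
  by rewrite scaler_eq0 expf_eq0 (negbTE nu0) andbF => /eqP.
Qed.

Lemma sub_scalar0 x : sub_scalar S 0 x = S x.
Proof. by rewrite sub_scalarE scale0r subr0. Qed.

Lemma defect_shift0 :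
  defect S (range_iter S d) = quotdim setT (shift_range 0).
Proof.
rewrite /defect -range_iterS.
apply: (@quotdim_rel _ _ (fun x y => x = iter d S y)).
- by rewrite iter_linear0.
- by move=> a _ x _ y -> ->; rewrite iter_linearP.
- exact: linsubspace_range_iter.
- exact: linsubspace_setT.
- by move=> _ [x _ <-]; exists x.
- by move=> y _; exists (iter d S y) => //; exists y.
- move=> x y _ _ ->; split=> [[z _ Sz]|[z]].
    exists z; rewrite /ker_iter /mkset sub_scalar0 iter_linearB -Sz.
    by rewrite -iterSr subrr.
  rewrite /ker_iter /mkset sub_scalar0 iter_linearB -iterSr => /eqP.
  by rewrite subr_eq0 => /eqP ->; exists z.
Qed.

Lemma nullity_shift0 :
  nullity S (range_iter S d) = quotdim (shift_ker 0) ker_iter.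
Proof.
apply: (@quotdim_rel _ _ (fun x y => x = iter d S y)).
- by rewrite iter_linear0.
- by move=> a _ x _ y -> ->; rewrite iter_linearP.
- exact/linsubspace_restr_ker/linsubspace_range_iter.
- exact: linsubspace_shift_ker.
- move=> _ [[x _ <-] /= Sx]; exists x => //.
  by rewrite /shift_ker /ker_iter /mkset sub_scalar0 -iterSr.
- move=> y; rewrite /shift_ker /ker_iter /mkset sub_scalar0 -iterSr => Sy.
  by exists (iter d S y) => //; split => //; exists y.
- by move=> x y _ _ ->.
Qed.

(** The resolvent-type identity behind the inclusions below: on V(nu), where
S - nu vanishes modulo K, the operator S - mu is multiplication by nu - mu. *)
Lemma sub_scalar_shift nu mu x :
  (nu - mu) *: x = sub_scalar S mu x - sub_scalar S nu x.
Proof. by rewrite !sub_scalarE opprB [RHS]addrC subrKA scalerBl. Qed.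

Lemma shift_ker_sub_range nu mu : nu != mu -> shift_ker nu `<=` shift_range mu.
Proof.
rewrite -subr_eq0 => nm x Vx; rewrite -[x](scalerK nm) sub_scalar_shift.
apply: linsubspaceZ; first exact: linsubspace_shift_range.
apply: linsubspaceB; first exact: linsubspace_shift_range.
  exact: sub_scalar_shift_range.
exact: ker_iter_sub_shift_range.
Qed.

Lemma ker_iter_sub_range nu j : nu != 0 ->
  ker_iter `<=` range_iter (sub_scalar S nu) j.
Proof.
move=> nu0; elim: j => [|j ih] x Kx; first by exists x.
have [k /ih Rk <-] := ker_iter_lift nu0 Kx.
by rewrite range_iterS; exists k.
Qed.

Lemma shift_ker_sub_range_iter nu mu j : nu != mu -> mu != 0 ->
  shift_ker nu `<=` range_iter (sub_scalar S mu) j.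
Proof.
move=> nm mu0 x Vx; elim: j => [|j ih]; first by exists x.
have sR := linsubspace_range_iter (sub_scalar S mu) j.+1.
move: nm; rewrite -subr_eq0 => nm; rewrite -[x](scalerK nm) sub_scalar_shift.
apply: linsubspaceZ => //; apply: linsubspaceB => //.
  by rewrite range_iterS; exists x.
exact: ker_iter_sub_range.
Qed.

End ShiftedOperators.

(** If S^(m+1) x = 0 with m >= d, then S^m x lies in N(S) and R(S^m), hence by
k_m = 0 it equals S^(m+1) w for some w, and x - S w lies in N(S^m). *)
Lemma ker_iter_sub_shift_range0 {R : realType} {X : lmodType R[i]}
    (S : {linear X -> X}) d m :
  (forall n, (d <= n)%N -> k_ S n = 0%E) -> (d <= m)%N ->
  ker_iter S m `<=` shift_range S d 0.
Proof.
move=> k0 /subnKC <-; elim: (m - d)%N => [|j ih] x.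
  by rewrite addn0; exact: ker_iter_sub_shift_range.
rewrite addnS => Sx.
have : range_iter S (d + j).+1 (iter (d + j) S x).
  have sR := linsubspace_restr_ker S (linsubspace_range_iter S (d + j).+1).
  have Nx : restr_ker S (range_iter S (d + j)) (iter (d + j) S x).
    by split=> //; exists x.
  by have [] := quotdim_eq0 sR (k0 (d + j)%N (leq_addr _ _)) Nx.
move=> [w _]; rewrite iterSr => Sw.
have /ih P : ker_iter S (d + j) (x - S w).
  by rewrite /ker_iter /= iter_linearB Sw subrr.
rewrite -(subrK (S w) x).
apply: linsubspaceD => //; first exact: linsubspace_shift_range.
by rewrite -sub_scalar0; exact: sub_scalar_shift_range.
Qed.

(** * Real-valued norms and geometric convergence *)
Section RealNorm.
Context {R : realType}.

Definition modulus (a : R[i]) : R := complex.Re `|a|.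

Lemma modulusE a : `|a| = (modulus a)%:C.
Proof. by rewrite RRe_real// ger0_real. Qed.

Lemma modulus_ge0 a : 0 <= modulus a.
Proof. by rewrite -ler0c -modulusE. Qed.

Lemma modulusN a : modulus (- a) = modulus a.
Proof. by rewrite /modulus normrN. Qed.

Lemma modulusB a b : modulus (a - b) = modulus (b - a).
Proof. by rewrite -modulusN opprB. Qed.

Lemma modulusM a b : modulus (a * b) = modulus a * modulus b.
Proof. by apply: complexI; rewrite -modulusE normrM !modulusE rmorphM. Qed.

Lemma modulus0 : modulus 0 = 0.
Proof. by rewrite /modulus normr0. Qed.

Lemma modulus_eq0 a : (modulus a == 0) = (a == 0).
Proof. by rewrite -(normr_eq0 a) modulusE -(inj_eq (@complexI R)). Qed.

Lemma modulus_real (r : R) : 0 <= r -> modulus r%:C = r.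
Proof. by move=> r0; rewrite /modulus ger0_norm// lecR. Qed.

Lemma Re_le_modulus a : `|complex.Re a| <= modulus a.
Proof.
by rewrite -lecR -modulusE normc_def lecR -[leLHS]sqrtr_sqr ler_wsqrtr// lerDl sqr_ge0.
Qed.

Lemma Im_le_modulus a : `|complex.Im a| <= modulus a.
Proof.
by rewrite -lecR -modulusE normc_def lecR -[leLHS]sqrtr_sqr ler_wsqrtr// lerDr sqr_ge0.
Qed.

Lemma modulus_le_Re_Im a : modulus a <= `|complex.Re a| + `|complex.Im a|.
Proof.
rewrite -lecR -modulusE normc_def lecR.
rewrite -[leRHS]ger0_norm ?addr_ge0// -[leRHS]sqrtr_sqr ler_wsqrtr//.
by rewrite sqrrD !real_normK ?num_real// lerD2r lerDl mulrn_wge0// mulr_ge0.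
Qed.

Section Norm.
Context {X : normedModType R[i]}.
Implicit Types x y : X.

Definition rnorm x : R := complex.Re `|x|.

Lemma rnormE x : `|x| = (rnorm x)%:C.
Proof. by rewrite RRe_real// ger0_real. Qed.

Lemma rnorm_ge0 x : 0 <= rnorm x.
Proof. by rewrite -ler0c -rnormE. Qed.

Lemma rnormD x y : rnorm (x + y) <= rnorm x + rnorm y.
Proof. by rewrite -lecR rmorphD /= -!rnormE ler_normD. Qed.

Lemma rnormN x : rnorm (- x) = rnorm x.
Proof. by rewrite /rnorm normrN. Qed.

Lemma rnormC x y : rnorm (x - y) = rnorm (y - x).
Proof. by rewrite -rnormN opprB. Qed.

Lemma rnormB x y : rnorm (x - y) <= rnorm x + rnorm y.
Proof. by rewrite -(rnormN y) rnormD. Qed.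

Lemma rnorm_triangle z x y : rnorm (x - y) <= rnorm (x - z) + rnorm (z - y).
Proof. by rewrite -(subrKA z x (- y)) rnormD. Qed.

Lemma rnormZ a x : rnorm (a *: x) = modulus a * rnorm x.
Proof. by apply: complexI; rewrite -rnormE normrZ modulusE rnormE rmorphM. Qed.

Lemma rnorm0 : rnorm 0 = 0.
Proof. by rewrite /rnorm normr0. Qed.

Lemma rnorm_eq0 x : (rnorm x == 0) = (x == 0).
Proof. by rewrite -(normr_eq0 x) rnormE -(inj_eq (@complexI R)). Qed.

Lemma rnorm_gt0 x : (0 < rnorm x) = (x != 0).
Proof. by rewrite lt0r rnorm_ge0 andbT rnorm_eq0. Qed.

(** Norms of X are elements of R[i], which is only partially ordered; with
[rnorm] and real radii all estimates take place in the ordered field R. *)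
Definition norm_closed (A : set X) : Prop :=
  forall x, (forall e : R, 0 < e -> exists2 y, A y & rnorm (x - y) < e) -> A x.

Lemma closed_norm_closed (A : set X) : closed A -> norm_closed A.
Proof.
move=> cA x xA; apply: cA => B /nbhs_ballP[e /= e0 eB].
have e0' : 0 < complex.Re e by move: e0; rewrite ltcE => /andP[].
have [y Ay xy] := xA _ e0'; exists y; split => //; apply: eB.
rewrite -ball_normE /ball_ /= rnormE -(RRe_real (ger0_real (ltW e0))).
by rewrite ltcR.
Qed.

Lemma continuous_rnorm_bounded (T : {linear X -> X}) :
  continuous T -> exists2 b : R, 0 < b & forall x, rnorm (T x) <= b * rnorm x.
Proof.
move=> /linear_bounded_continuous /linear_boundedP /pinfty_ex_gt0[b b0 Tb].
exists (complex.Re b); first by move: b0; rewrite ltcE => /andP[].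
move=> x; rewrite -lecR rmorphM /= -!rnormE (RRe_real (ger0_real (ltW b0))).
exact: Tb.
Qed.

End Norm.

Lemma cauchy_limit (F : numFieldType) (X : completeNormedModType F) (u : nat -> X) :
  (forall e : F, 0 < e -> exists N, forall n, (N <= n)%N -> `|u N - u n| < e) ->
  exists l, forall e : F, 0 < e -> exists N, forall n, (N <= n)%N -> `|l - u n| < e.
Proof.
move=> uC; have : cvg (u @ \oo).
  apply: cauchy_cvg; apply: cauchy_exP => e e0; have [N uN] := uC e e0.
  exists (u N); rewrite -ball_normE; exists N => // n /=; exact: uN.
move=> /cvg_ex[l ul]; exists l => e e0.
by have /cvgrPdist_lt /(_ e e0)[N _ lN] := ul; exists N => n /lN.
Qed.

Lemma geometric_lt (C e : R) : 0 < e -> exists N, C * 2^-1 ^+ N < e.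
Proof.
move=> e0; exists (Num.trunc (C / e)).+1.
rewrite exprVn -ltr_pdivlMr ?invr_gt0 ?exprn_gt0// invrK mulrC -ltr_pdivrMr//.
apply: lt_trans (truncnS_gt _) _.
by rewrite -natrX ltr_nat ltn_expl.
Qed.

Lemma half_expn_ge0 n : 0 <= 2^-1 ^+ n :> R.
Proof. by rewrite exprn_ge0. Qed.

Lemma geometric_telescope (dist : nat -> nat -> R) (C : R) : 0 <= C ->
    (forall n, dist n n = 0) ->
    (forall m n p, dist m p <= dist m n + dist n p) ->
    (forall n, dist n n.+1 <= C * 2^-1 ^+ n) ->
  forall m n, (m <= n)%N -> dist m n <= 2 * C * 2^-1 ^+ m.
Proof.
move=> C0 d0 dD dC m n /subnKC <-.
suff : dist m (m + (n - m))%N <= 2 * C * (2^-1 ^+ m - 2^-1 ^+ (m + (n - m))).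
  move=> /le_trans; apply; rewrite ler_wpM2l ?mulr_ge0// gerBl.
  exact: half_expn_ge0.
elim: (n - m)%N => [|k ih]; first by rewrite addn0 d0 subrr mulr0.
rewrite addnS; apply: le_trans (dD _ (m + k)%N _) _.
have := dC (m + k)%N; rewrite [_ ^+ (_ + _).+1]exprSr; move: ih.
by set x := _ ^+ (m + k); lra.
Qed.

(** Completeness of X enters through this lemma. Steps of size C 2^-n suffice,
as every approximation below can be made to improve by a factor 2, and the
bound at n = 0 controls the size of the limit. *)
Lemma geometric_limit (X : completeNormedModType R[i]) (u : nat -> X) (C : R) :
    0 <= C -> (forall n, rnorm (u n - u n.+1) <= C * 2^-1 ^+ n) ->
  exists l, forall n, rnorm (l - u n) <= 2 * C * 2^-1 ^+ n.
Proof.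
move=> C0 uC.
have uT m n : (m <= n)%N -> rnorm (u m - u n) <= 2 * C * 2^-1 ^+ m.
  apply: (@geometric_telescope (fun m n => rnorm (u m - u n)) C) => // {m n} [n|m n p].
    by rewrite subrr rnorm0.
  exact: rnorm_triangle.
have [|l ul] := @cauchy_limit _ X u.
  move=> e e0; have e0' : 0 < complex.Re e by move: e0; rewrite ltcE => /andP[].
  have [N NC] := geometric_lt (2 * C) e0'; exists N => n /uT uNn.
  rewrite rnormE -(RRe_real (ger0_real (ltW e0))) ltcR.
  exact: le_lt_trans NC.
exists l => n; apply/ler_addgt0Pr => e e0.
have [|N lN] := ul e%:C; first by rewrite ltcR.
have := lN (maxn N n) (leq_maxl _ _); rewrite rnormE ltcR => le.
apply: le_trans (rnorm_triangle (u (maxn N n)) _ _) _.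
by rewrite addrC lerD ?(ltW le)// rnormC; exact: uT (leq_maxr _ _).
Qed.

Lemma real_geometric_limit (u : nat -> R) (C : R) :
    0 <= C -> (forall n, `|u n - u n.+1| <= C * 2^-1 ^+ n) ->
  exists l, forall n, `|l - u n| <= 2 * C * 2^-1 ^+ n.
Proof.
move=> C0 uC.
have uT m n : (m <= n)%N -> `|u m - u n| <= 2 * C * 2^-1 ^+ m.
  apply: (@geometric_telescope (fun m n => `|u m - u n|) C) => // {m n} [n|m n p].
    by rewrite subrr normr0.
  exact: ler_distD.
have [|l ul] := @cauchy_limit _ R^o u.
  move=> e e0; have [N NC] := geometric_lt (2 * C) e0; exists N => n /uT uNn.
  exact: le_lt_trans NC.
exists l => n; apply/ler_addgt0Pr => e e0.
have [//|N lN] := ul e.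
have /ltW le := lN (maxn N n) (leq_maxl _ _).
apply: le_trans (ler_distD (u (maxn N n)) _ _) _.
by rewrite addrC lerD// distrC; exact: uT (leq_maxr _ _).
Qed.

Lemma complex_geometric_limit (u : nat -> R[i]) (C : R) :
    0 <= C -> (forall n, modulus (u n - u n.+1) <= C * 2^-1 ^+ n) ->
  exists l, forall n, modulus (l - u n) <= 4 * C * 2^-1 ^+ n.
Proof.
move=> C0 uC.
have [||a aP] := @real_geometric_limit (fun n => complex.Re (u n)) C => //.
  move=> n; apply: le_trans (uC n).
  by have := Re_le_modulus (u n - u n.+1); case: (u n) (u n.+1) => [? ?] [? ?].
have [||b bP] := @real_geometric_limit (fun n => complex.Im (u n)) C => //.
  move=> n; apply: le_trans (uC n).
  by have := Im_le_modulus (u n - u n.+1); case: (u n) (u n.+1) => [? ?] [? ?].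
exists (a +i* b) => n; apply: le_trans (modulus_le_Re_Im _) _.
have := lerD (aP n) (bP n); case: (u n) => [x y] /= /le_trans; apply.
by rewrite le_eqVlt; apply/orP; left; apply/eqP; ring.
Qed.

End RealNorm.

(** * Riesz families and close subspaces *)
Section Gap.
Context {R : realType} {X : completeNormedModType R[i]}.
Implicit Types (K V U P : set X).

Lemma rnorm_sum n (c : 'I_n -> R[i]) (v : 'I_n -> X) :
  rnorm (\sum_i c i *: v i) <= \sum_i modulus (c i) * rnorm (v i).
Proof.
elim/big_rec2: _ => [|i x y _ xy]; first by rewrite rnorm0.
by apply: le_trans (rnormD _ _) _; rewrite rnormZ lerD2l.
Qed.

(** If no point of V were within a factor 2 of realizing the distance to x, one
could halve the distance again and again, and x would belong to the closure of
V. *)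
Lemma almost_nearest V x : norm_closed V -> V !=set0 ->
  exists2 a, V a & forall b, V b -> rnorm (x - a) <= 2 * rnorm (x - b).
Proof.
move=> cV [a0 Va0].
have [Vx|Vx] := pselect (V x).
  by exists x => // b _; rewrite subrr rnorm0 mulr_ge0 ?rnorm_ge0.
have [e e0 eV] : exists2 e : R, 0 < e & forall b, V b -> e <= rnorm (x - b).
  apply: contrapT => ne; apply: Vx; apply: cV => e e0.
  apply: contrapT => nb; apply: ne; exists e => // b Vb.
  by rewrite leNgt; apply/negP => be; apply: nb; exists b.
apply: contrapT => nmin.
have step a : V a -> exists2 b, V b & 2 * rnorm (x - b) < rnorm (x - a).
  move=> Va; apply: contrapT => nb; apply: nmin; exists a => // b Vb.
  by rewrite leNgt; apply/negP => ba; apply: nb; exists b.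
have small n : exists2 b, V b & rnorm (x - b) <= rnorm (x - a0) * 2^-1 ^+ n.
  elim: n => [|n [b Vb bn]]; first by exists a0 => //; rewrite mulr1.
  have [c Vc cb] := step b Vb; exists c => //.
  by rewrite exprS; move: bn cb; lra.
have [N NC] := geometric_lt (rnorm (x - a0)) e0.
have [b Vb bN] := small N.
by have := le_lt_trans bN NC; rewrite ltNge eV.
Qed.

Definition add_line K v : set X := [set x | exists a : R[i], K (x - a *: v)].

Lemma linsubspace_add_line K v : linsubspace K -> linsubspace (add_line K v).
Proof.
move=> sK; split; first by exists 0; rewrite scale0r subr0; case: sK.
move=> a x y [b Kb] [c Kc]; exists (a * b + c).
rewrite scalerDl opprD addrACA -scalerA -scalerBr.
by case: sK => _; exact.
Qed.

Lemma modulus_le_line K v a k : linsubspace K ->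
    (forall k, K k -> 2^-1 <= rnorm (v - k)) ->
  K k -> modulus a <= 2 * rnorm (a *: v - k).
Proof.
move=> sK vK Kk; have [->|a0] := eqVneq a 0.
  by rewrite modulus0 mulr_ge0 ?rnorm_ge0.
have := vK (a^-1 *: k) (linsubspaceZ _ sK Kk).
have -> : a *: v - k = a *: (v - a^-1 *: k).
  by rewrite scalerBr scalerA divff// scale1r.
rewrite rnormZ mulrCA; move: (modulus_ge0 a) => ma h.
by rewrite -[leLHS]mulr1 ler_wpM2l//; lra.
Qed.

(** Since v stays at distance 1/2 from K, the coefficient of v is controlled by
the norm ([modulus_le_line]); so coefficients of a convergent sequence
converge, and what remains converges in K. *)
Lemma norm_closed_add_line K v : linsubspace K -> norm_closed K ->
    (forall k, K k -> 2^-1 <= rnorm (v - k)) ->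
  norm_closed (add_line K v).
Proof.
move=> sK cK vK y yK.
have /choice[z zP] : forall n, exists z : X * R[i],
    K (z.1 - z.2 *: v) /\ rnorm (y - z.1) < 2^-1 ^+ n.
  move=> n; have [|t [a Ka] yt] := yK (2^-1 ^+ n); first by rewrite exprn_gt0.
  by exists (t, a).
have [||a aP] := @complex_geometric_limit R (fun n => (z n).2) 4; first by [].
  move=> n; have [K0 z0] := zP n; have [K1 z1] := zP n.+1.
  have := modulus_le_line ((z n).2 - (z n.+1).2) sK vK
    (linsubspaceB sK K1 K0).
  have -> : ((z n).2 - (z n.+1).2) *: v -
     ((z n.+1).1 - (z n.+1).2 *: v - ((z n).1 - (z n).2 *: v)) =
     (z n).1 - (z n.+1).1.
    by rewrite scalerBl !opprB addrCA !subrKA.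
  have := rnorm_triangle y (z n).1 (z n.+1).1.
  rewrite (rnormC _ y); move: z1 (@half_expn_ge0 R n); rewrite exprS; lra.
exists a; apply: cK => e e0.
have [N NC] := geometric_lt (1 + 16 * rnorm v) e0.
have [Kz yz] := zP N; exists ((z N).1 - (z N).2 *: v) => //.
apply: le_lt_trans NC.
have -> : y - a *: v - ((z N).1 - (z N).2 *: v) =
    (y - (z N).1) - (a - (z N).2) *: v.
  by rewrite scalerBl !opprD addrACA.
apply: le_trans (rnormB _ _) _; rewrite rnormZ.
have := ler_wpM2r (rnorm_ge0 v) (aP N); move: yz; lra.
Qed.

Lemma riesz_vector K V : linsubspace K -> norm_closed K -> linsubspace V ->
    K `<=` V -> ~ V `<=` K ->
  exists v, [/\ V v, rnorm v <= 1 & forall k, K k -> 2^-1 <= rnorm (v - k)].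
Proof.
move=> sK cK sV KV /existsNP[x /not_implyP[Vx Kx]].
have [|a Ka amin] := almost_nearest x cK; first by exists 0; case: sK.
have xa : 0 < rnorm (x - a).
  rewrite rnorm_gt0; apply/eqP => /eqP; rewrite subr_eq0 => /eqP xa.
  by apply: Kx; rewrite xa.
pose s : R := (rnorm (x - a))^-1.
have s0 : 0 < s by rewrite invr_gt0.
exists (s%:C *: (x - a)); split.
- by apply: linsubspaceZ => //; apply: linsubspaceB => //; exact: KV.
- by rewrite rnormZ modulus_real ?(ltW s0)// mulVf ?gt_eqF.
- move=> k Kk.
  have sC0 : s%:C != 0 by rewrite (inj_eq (@complexI R) s 0) gt_eqF.
  have -> : s%:C *: (x - a) - k = s%:C *: (x - (a + (s%:C)^-1 *: k)).
    by rewrite opprD addrA [in RHS]scalerBr scalerA divff// scale1r.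
  rewrite rnormZ modulus_real ?(ltW s0)//.
  have := amin (a + (s%:C)^-1 *: k) (linsubspaceD sK Ka (linsubspaceZ _ sK Kk)).
  rewrite -ler_pdivrMl// => /(ler_wpM2l (ltW s0)); rewrite mulrCA mulVf ?gt_eqF//.
  by rewrite mulr1.
Qed.

Lemma has_free_add_line K V v n : linsubspace K -> K `<=` V -> linsubspace V -> V v ->
  has_free V K n.+1 -> has_free V (add_line K v) n.
Proof.
move=> sK KV sV Vv fV; apply: contrapT => nf.
have sL := linsubspace_add_line v sK.
have KL : K `<=` add_line K v by move=> k Kk; exists 0; rewrite scale0r subr0.
have LV : add_line K v `<=` V.
  move=> x [a Ka]; rewrite -(subrK (a *: v) x); apply: linsubspaceD => //.
    exact: KV.
  exact: linsubspaceZ.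
have : (n.+1%:R%:E <= quotdim V K)%E by apply/quotdim_geP.
rewrite (quotdimD KL LV sL sK).
have [[_ /(_ n)]//|[m [-> fm _]]] := quotdimP V (add_line K v).
have line1 j : has_free (add_line K v) K j -> (j <= 1)%N.
  apply: (free_leq_span (g := fun=> v)) => // x [a Ka].
  by exists (fun=> a); rewrite big_ord1.
have [[_ /(_ 2)/line1]//|[q [-> /line1 q1 _]]] := quotdimP (add_line K v) K.
rewrite -EFinD lee_fin -natrD ler_nat => nmq; apply: nf.
apply: has_free_leq fm; move: nmq q1; lia.
Qed.

(** The constant g depends on n only, and not on the subspaces; this uniformity
is what makes the steps in [disc_chain] of constant length. The family is built
by induction: a Riesz vector v0 for K, then a family for K + <v0>. *)
Lemma riesz_family n : exists2 g : R, 0 < g & forall K V,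
  linsubspace K -> norm_closed K -> linsubspace V -> K `<=` V ->
  has_free V K n ->
  exists v : 'I_n -> X, (forall i, V (v i) /\ rnorm (v i) <= 1) /\
    forall (c : 'I_n -> R[i]) k, K k ->
      forall i, g * modulus (c i) <= rnorm (\sum_j c j *: v j - k).
Proof.
elim: n => [|n [g g0 ih]].
  by exists 1 => // K V _ _ _ _ _; exists (fun=> 0); split => [[]//|c k _ []].
(* if t bounds the norm of the combination, the coefficients other than that
   of v0 are at most t / g, and then |c0| / 2 <= t + n t / g *)
pose h : R := (2 * (1 + n%:R / g))^-1.
have ng : 0 <= n%:R / g by rewrite divr_ge0 ?(ltW g0).
have h1 : 0 < 2 * (1 + n%:R / g) by apply: mulr_gt0 => //; apply: ltr_pwDl.
have h0 : 0 < h by rewrite invr_gt0.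
exists (Num.min g h); first by rewrite lt_min g0.
move=> K V sK cK sV KV fV.
have [|v0 [Vv0 v01 v0K]] := riesz_vector sK cK sV KV.
  move=> VK; suff : (n.+1 <= 0)%N by [].
  apply: (free_leq_span (g := fun=> 0) sK) fV => x /VK Kx.
  by exists (fun=> 0); rewrite big_ord0 subr0.
have sL := linsubspace_add_line v0 sK.
have cL := norm_closed_add_line sK cK v0K.
have LV : add_line K v0 `<=` V.
  move=> x [a Ka]; rewrite -(subrK (a *: v0) x); apply: linsubspaceD => //.
    exact: KV.
  exact: linsubspaceZ.
have [w [wP wg]] := ih _ _ sL cL sV LV (has_free_add_line sK KV sV Vv0 fV).
exists (fun i => oapp w v0 (unlift ord0 i)); split.
  by move=> i; case: unliftP => [j _|_] /=.
move=> c k Kk.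
set t := rnorm _.
pose s := \sum_(j < n) c (lift ord0 j) *: w j.
have tE : t = rnorm (c ord0 *: v0 + s - k).
  rewrite /t big_ord_recl unlift_none /=; congr (rnorm (_ + _ - _)).
  by apply: eq_bigr => j _; rewrite liftK.
have cj j : g * modulus (c (lift ord0 j)) <= t.
  have Lk : add_line K v0 (k - c ord0 *: v0).
    exists (- c ord0); rewrite scaleNr opprK subrK //.
  have := wg (fun j => c (lift ord0 j)) _ Lk j.
  by rewrite tE opprB addrA [s + _]addrC.
move=> i; case: (unliftP ord0 i) => [j ->|->].
  apply: le_trans (cj j); rewrite ler_wpM2r ?modulus_ge0// ge_min lexx //.
apply: (@le_trans _ _ (h * modulus (c ord0))).
  by rewrite ler_wpM2r ?modulus_ge0// ge_min lexx orbT.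
have sn : rnorm s <= n%:R * (t / g).
  apply: le_trans (rnorm_sum _ _) _.
  rewrite -[n in n%:R]card_ord -sum1_card natr_sum mulr_suml ler_sum// => j _.
  have [_ wj] := wP j; rewrite mul1r ler_pdivlMr// mulrC.
  by apply: le_trans (cj j); rewrite ler_wpM2l ?(ltW g0)// ler_piMr// modulus_ge0.
have c0 : modulus (c ord0) <= 2 * rnorm (c ord0 *: v0 - k).
  exact: (modulus_le_line _ sK v0K Kk).
have ts : rnorm (c ord0 *: v0 - k) <= t + rnorm s.
  rewrite tE -[c ord0 *: v0 - k](addrK s); apply: le_trans (rnormB _ _) _.
  by rewrite addrAC.
rewrite /h ler_pdivrMl//.
move: c0 ts sn; rewrite mulrCA; move: (n%:R / g) => q; lra.
Qed.


(** Summing the n inequalities gives sum a <= (n / (n + 1)) sum a. *)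
Lemma coefficients_eq0 n (a : 'I_n -> R) (g : R) : (forall i, 0 <= a i) ->
  0 < g -> (forall i, g * a i <= g / n.+1%:R * \sum_j a j) -> forall i, a i = 0.
Proof.
move=> a0 g0 ga.
have s0 : 0 <= \sum_j a j by exact: sumr_ge0.
suff /eqP : \sum_j a j = 0 by rewrite psumr_eq0// => /allP a00 i; apply/eqP/a00/mem_index_enum.
have : \sum_j a j <= \sum_(j < n) (\sum_j a j) / n.+1%:R.
  apply: ler_sum => i _; have := ga i.
  by rewrite -mulrA ler_pM2l// mulrC.
rewrite sumr_const card_ord -[leRHS]mulr_natr -mulrA => h; apply/eqP.
rewrite eq_le s0 andbT leNgt; apply/negP => sp.
move: h; rewrite -[leLHS]mulr1 ler_pM2l// leNgt => /negP; apply.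
by rewrite mulrC ltr_pdivrMr// mul1r ltr_nat.
Qed.

Definition close_within (r : R) V U := forall x, V x ->
  exists2 y, U y & rnorm (x - y) <= r * rnorm x.

(** A Riesz family of V moved by less than g / (n + 1) stays free modulo K: a
dependence would make its own combination smaller than the family allows. *)
Lemma gap_lemma n : exists2 r : R, 0 < r & forall K V U,
  linsubspace K -> norm_closed K -> linsubspace V -> K `<=` V ->
  close_within r V U -> has_free V K n -> has_free U K n.
Proof.
have [g g0 gP] := riesz_family n; exists (g / n.+1%:R); first exact: divr_gt0.
move=> K V U sK cK sV KV VU fV.
have [v [vP vg]] := gP _ _ sK cK sV KV fV.
have /choice[u uP] : forall i, exists y, U y /\
    rnorm (v i - y) <= g / n.+1%:R.
  move=> i; have [Vi v1] := vP i; have [y Uy vy] := VU _ Vi.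
  exists y; split=> //; apply: le_trans vy _.
  by rewrite ler_piMr// divr_ge0 ?(ltW g0).
exists u; split=> [i|c Kc]; first by have [] := uP i.
suff h i : modulus (c i) = 0 by move=> i; apply/eqP; rewrite -modulus_eq0 h.
move: i; apply: (coefficients_eq0 (fun i => modulus_ge0 (c i)) g0) => i.
apply: le_trans (vg c _ Kc i) _; rewrite -sumrB.
under eq_bigr do rewrite -scalerBr.
apply: le_trans (rnorm_sum _ _) _; rewrite mulr_sumr; apply: ler_sum => j _.
by rewrite mulrC ler_wpM2r ?modulus_ge0//; have [] := uP j.
Qed.

(** Here the vectors of the family stay and the subspace moves: a combination
which lies in P is almost in Q, and the Riesz property modulo Q forbids it. *)
Lemma codim_gap_lemma n : exists2 r : R, 0 < r & forall P Q,
  linsubspace Q -> norm_closed Q -> close_within r P Q ->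
  has_free setT Q n -> has_free setT P n.
Proof.
have [g g0 gP] := riesz_family n; exists (g / n.+1%:R); first exact: divr_gt0.
move=> P Q sQ cQ PQ fQ.
have [//|v [vP vg]] := gP _ _ sQ cQ linsubspace_setT _ fQ.
exists v; split=> [//|c Pc].
suff h i : modulus (c i) = 0 by move=> i; apply/eqP; rewrite -modulus_eq0 h.
move: i; apply: (coefficients_eq0 (fun i => modulus_ge0 (c i)) g0) => i.
have [y Qy cy] := PQ _ Pc.
apply: le_trans (vg c _ Qy i) (le_trans cy _).
rewrite ler_wpM2l// ?divr_ge0 ?(ltW g0)//.
apply: le_trans (rnorm_sum _ _) _; apply: ler_sum => j _.
by rewrite ler_piMr ?modulus_ge0//; have [] := vP j.
Qed.

End Gap.

(** * The open mapping theorem modulo a closed subspace *)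
Section Lifting.
Context {R : realType} {X : completeNormedModType R[i]}.
Variables (T : {linear X -> X}) (b : R) (K : set X).
Hypotheses (b0 : 0 < b) (Tb : forall x, rnorm (T x) <= b * rnorm x).
Hypotheses (sK : linsubspace K) (cK : norm_closed K).

Definition range_mod : set X := [set y | exists x, K (y - T x)].

Definition lifts_with (c : R) : Prop :=
  forall y, range_mod y -> exists x, K (y - T x) /\ rnorm x <= c * rnorm y.

Lemma linsubspace_range_mod : linsubspace range_mod.
Proof.
split; first by exists 0; rewrite linear0 subrr; case: sK.
move=> a x y [z Kz] [t Kt]; exists (a *: z + t).
rewrite linearP opprD addrACA -scalerBr.
by case: sK => _; exact.
Qed.

(** Used whenever an equation modulo K is solved by successive approximation:
the w n are approximate right-hand sides, the s n exact solutions for them. *)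
Lemma range_mod_limit (y l : X) (w s : nat -> X) (C D : R) :
  (forall n, K (w n - T (s n))) ->
  (forall n, rnorm (y - w n) <= C * 2^-1 ^+ n) ->
  (forall n, rnorm (l - s n) <= D * 2^-1 ^+ n) -> K (y - T l).
Proof.
move=> Kw yw ls; apply: cK => e e0.
have [N NC] := geometric_lt (C + b * D) e0.
exists (w N - T (s N)) => //; apply: le_lt_trans NC.
have -> : y - T l - (w N - T (s N)) = (y - w N) - T (l - s N).
  by rewrite (linearB T) !opprD addrACA.
apply: le_trans (rnormB _ _) _; rewrite mulrDl -mulrA.
apply: lerD => //; apply: le_trans (Tb _) _.
by rewrite ler_wpM2l ?(ltW b0).
Qed.

Lemma lifts_norm_closed c : 0 < c -> lifts_with c -> norm_closed range_mod.
Proof.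
move=> c0 Tc y yM.
have /choice[w wP] : forall n, exists z, range_mod z /\ rnorm (y - z) < 2^-1 ^+ n.
  move=> n; have [|z Mz yz] := yM (2^-1 ^+ n); first by rewrite exprn_gt0.
  by exists z.
have [x0 Kx0] := (wP 0%N).1.
have /choice[x xP] n : exists x, K (w n.+1 - w n - T x) /\
    rnorm x <= c * rnorm (w n.+1 - w n).
  by apply/Tc/(linsubspaceB linsubspace_range_mod); case: (wP n); case: (wP n.+1).
pose s n := x0 + \sum_(i < n) x i.
have sS n : s n.+1 = s n + x n by rewrite /s big_ord_recr addrA.
have Ks n : K (w n - T (s n)).
  elim: n => [|n ih]; first by rewrite /s big_ord0 addr0.
  have -> : w n.+1 - T (s n.+1) = (w n.+1 - w n - T (x n)) + (w n - T (s n)).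
    by rewrite sS (linearD T) opprD addrACA subrK [- T (x n) - _]addrC.
  by apply: linsubspaceD => //; have [] := xP n.
have [||l ls] := @geometric_limit R X s (2 * c); first by rewrite mulr_ge0 ?ltW.
  move=> n; rewrite sS opprD addrA subrr sub0r rnormN.
  apply: le_trans (xP n).2 _; rewrite [2 * c]mulrC -mulrA ler_pM2l//.
  apply: le_trans (rnorm_triangle y _ _) _; rewrite (rnormC _ y).
  have := (wP n).2; have := (wP n.+1).2; rewrite exprS.
  have := @half_expn_ge0 R n; lra.
exists l; apply: (@range_mod_limit y l w s 1) Ks _ ls => n.
by rewrite mul1r ltW//; have [] := wP n.
Qed.

(** Newton-type iteration: lift the remaining error, which is halved at every
step, and sum the corrections. *)
Lemma lifts_of_approximate_lifts c : 0 < c ->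
    (forall y, range_mod y -> exists x z,
      [/\ K (z - T x), rnorm (y - z) <= 2^-1 * rnorm y & rnorm x <= c * rnorm y]) ->
  lifts_with (2 * c).
Proof.
move=> c0 app y My.
have /choice[f fP] (w : X) : exists p : X * X, range_mod w ->
    [/\ K (p.2 - T p.1), rnorm (w - p.2) <= 2^-1 * rnorm w & rnorm p.1 <= c * rnorm w].
  have [/app[x [z xz]]|nM] := pselect (range_mod w); first by exists (x, z).
  by exists (0, 0).
pose w n := iter n (fun w => w - (f w).2) y.
have Mw n : range_mod (w n).
  elim: n => [//|n ih]; apply: (linsubspaceB linsubspace_range_mod ih).
  by have [Kf _ _] := fP _ ih; exists (f (w n)).1.
have wn n : rnorm (w n) <= rnorm y * 2^-1 ^+ n.
  elim: n => [|n ih]; first by rewrite mulr1.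
  have [_ fw _] := fP _ (Mw n); apply: le_trans fw _.
  by rewrite exprS mulrCA ler_pM2l.
pose s n := \sum_(i < n) (f (w i)).1.
have sS n : s n.+1 = s n + (f (w n)).1 by rewrite /s big_ord_recr.
have Ks n : K (y - w n - T (s n)).
  elim: n => [|n ih].
    by rewrite /s big_ord0 linear0 subrr subr0; case: sK.
  have -> : y - w n.+1 - T (s n.+1) = (y - w n - T (s n)) + ((f (w n)).2 - T (f (w n)).1).
    by rewrite sS (linearD T) -[w n.+1]/(w n - _) !opprD opprK [y + (_ + _)]addrA [RHS]addrACA.
  by apply: linsubspaceD => //; have [] := fP _ (Mw n).
have [||l ls] := @geometric_limit R X s (c * rnorm y).
- by rewrite mulr_ge0 ?rnorm_ge0 ?ltW.
- move=> n; rewrite sS opprD addrA subrr sub0r rnormN.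
  have [_ _ fw] := fP _ (Mw n); apply: le_trans fw _.
  by rewrite -mulrA ler_pM2l.
exists l; split.
  apply: (@range_mod_limit y l (fun n => y - w n) s (rnorm y)) Ks _ ls => n.
  by rewrite opprB addrC subrK.
by have := ls 0%N; rewrite /s big_ord0 subr0 mulr1 mulrA.
Qed.

(** The closed subspace R(T) + K is the union of the sets A n. If some A n is
dense in a ball, scaling gives approximate lifts. Otherwise nested balls, the
n-th missing A n, shrink to a point of R(T) + K in none of the A n; recentring
at 0 is possible because differences of elements of A n lie in A (2n). *)
Lemma open_mapping : norm_closed range_mod -> exists2 c : R, 0 < c & lifts_with c.
Proof.
move=> cM.
have sM := linsubspace_range_mod.
pose A (n : nat) y := exists2 x, rnorm x <= n%:R & K (y - T x).
pose dense_in n (r : R) := forall y, range_mod y -> rnorm y < r ->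
  forall e, 0 < e -> exists2 z, A n z & rnorm (y - z) < e.
have [[n [r r0 nr]]|ndense] := pselect (exists n, exists2 r : R, 0 < r & dense_in n r).
  have c0 : 0 < 2 * (n.+1%:R / r) :> R by rewrite mulr_gt0 ?divr_gt0.
  exists (2 * (2 * (n.+1%:R / r))); first by rewrite mulr_gt0.
  apply: lifts_of_approximate_lifts => // y My.
  have [->|y0] := eqVneq y 0.
    exists 0, 0; rewrite linear0 !subrr rnorm0 !mulr0; split => //.
    by case: sK.
  have yp : 0 < rnorm y by rewrite rnorm_gt0.
  pose t := 2 * rnorm y / r.
  have t0 : 0 < t by rewrite divr_gt0 ?mulr_gt0.
  have tC0 : t%:C != 0 by rewrite (inj_eq (@complexI R) t 0) gt_eqF.
  have tr : t * r = 2 * rnorm y by rewrite divfK ?gt_eqF.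
  have [|||z [x xn Kx] yz] := nr ((t%:C)^-1 *: y) _ _ (4^-1 * r).
  - exact: linsubspaceZ.
  - rewrite rnormZ -fmorphV modulus_real ?invr_ge0 ?(ltW t0)//.
    by rewrite ltr_pdivrMl// tr; lra.
  - by rewrite mulr_gt0.
  exists (t%:C *: x), (t%:C *: z); split.
  - by rewrite linearZ /= -scalerBr; exact: linsubspaceZ.
  - have -> : y - t%:C *: z = t%:C *: (t%:C^-1 *: y - z).
      by rewrite scalerBr scalerA divff// scale1r.
    rewrite rnormZ modulus_real ?(ltW t0)//.
    move: yz => /ltW /(ler_wpM2l (ltW t0)); rewrite mulrCA tr; lra.
  - rewrite rnormZ modulus_real ?(ltW t0)//.
    apply: (@le_trans _ _ (t * n.+1%:R)).
      by rewrite ler_pM2l// (le_trans xn)// ler_nat.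
    by rewrite /t le_eqVlt; apply/orP; left; apply/eqP; ring.
exfalso.
have step n z (r : R) : range_mod z -> 0 < r -> exists p : X * R,
    [/\ range_mod p.1, 0 < p.2, rnorm (z - p.1) < r, p.2 <= r &
     forall y, rnorm (p.1 - y) <= p.2 -> ~ A n y].
  move=> Mz r0; apply: contrapT => np; apply: ndense; exists (n + n)%N, r => //.
  have near z' : range_mod z' -> rnorm (z - z') < r ->
      forall e, 0 < e -> exists2 y, A n y & rnorm (z' - y) < e.
    move=> Mz' zz' e e0; apply: contrapT => ny; apply: np.
    pose e' := Num.min (2^-1 * e) r.
    have e'0 : 0 < e' by rewrite lt_min r0 mulr_gt0.
    exists (z', e'); split=> //=; first by rewrite ge_min lexx orbT.
    move=> y ye Ay; apply: ny; exists y => //; apply: le_lt_trans ye _.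
    by rewrite gt_min; apply/orP; left; lra.
  move=> y My yr e e0.
  have e20 : 0 < 2^-1 * e by rewrite mulr_gt0.
  have [|y1 [x1 x1n Kx1] zy1] := near z Mz _ _ e20; first by rewrite subrr rnorm0.
  have [||y2 [x2 x2n Kx2] zy2] := near (z + y) _ _ _ e20.
  - exact: linsubspaceD.
  - by rewrite opprD addrA subrr sub0r rnormN.
  exists (y2 - y1).
    exists (x2 - x1).
      by apply: le_trans (rnormB _ _) _; rewrite natrD lerD.
    have -> : y2 - y1 - T (x2 - x1) = (y2 - T x2) - (y1 - T x1).
      by rewrite (linearB T) !opprD addrACA.
    exact: linsubspaceB.
  have -> : y - (y2 - y1) = (z + y - y2) - (z - y1).
    by rewrite [z + y]addrC -[y + z - y2]addrA -[RHS]addrA !opprB [z - y2 + _]addrC subrKA.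
  by apply: le_lt_trans (rnormB _ _) _; move: zy1 zy2; lra.
have /choice[f fP] (p : nat * (X * R)) : exists q : X * R,
    range_mod p.2.1 /\ 0 < p.2.2 ->
    [/\ range_mod q.1, 0 < q.2, rnorm (p.2.1 - q.1) <= p.2.2 - q.2,
      q.2 <= 2^-1 * p.2.2 & forall y, rnorm (q.1 - y) <= q.2 -> ~ A p.1 y].
  have [[Mp p0]|] := pselect (range_mod p.2.1 /\ 0 < p.2.2); last by exists p.2.
  have [|q [Mq q0 pq qr qA]] := step p.1 p.2.1 (4^-1 * p.2.2) Mp.
    by rewrite mulr_gt0.
  by exists q => _; split=> //; lra.
pose z := fix z n := if n is m.+1 then f (m, z m) else (0 : X, 1 : R).
have zP n : range_mod (z n).1 /\ 0 < (z n).2.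
  elim: n => [|n ih] /=; first by split=> //; case: sM.
  by have [] := fP (n, z n) ih.
have zr n : (z n).2 <= 2^-1 ^+ n.
  elim: n => [//|n ih]; have [_ _ _ + _] := fP (n, z n) (zP n).
  by move=> /le_trans; apply; rewrite exprS ler_pM2l.
have [||l lz] := @geometric_limit R X (fun n => (z n).1) 1; first by [].
  move=> n; have [_ q0 + _ _] := fP (n, z n) (zP n).
  by move=> /le_trans; apply; have := zr n; rewrite mul1r /= in q0 *; lra.
have zz n k : rnorm ((z n).1 - (z (n + k)%N).1) <= (z n).2 - (z (n + k)%N).2.
  elim: k => [|k ih]; first by rewrite addn0 !subrr rnorm0.
  rewrite addnS; apply: le_trans (rnorm_triangle (z (n + k)%N).1 _ _) _.
  by have [_ _ + _ _] := fP ((n + k)%N, z (n + k)%N) (zP _); move: ih => /=; lra.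
have zl n : rnorm ((z n).1 - l) <= (z n).2.
  apply/ler_addgt0Pr => e e0; have [N Ne] := geometric_lt (2 * 1) e0.
  apply: le_trans (rnorm_triangle (z (n + N)%N).1 _ _) _.
  apply: lerD; first by have [_ p0] := zP (n + N)%N; have := zz n N; lra.
  rewrite rnormC; apply: le_trans (lz _) _; apply: le_trans (ltW Ne).
  rewrite ler_pM2l// exprD; apply: ler_piMl; first exact: half_expn_ge0.
  by rewrite exprn_ile1// invf_le1// ler1n.
have [x Kx] : range_mod l.
  apply: cM => e e0; have [N Ne] := geometric_lt (2 * 1) e0.
  exists (z N).1; first by have [] := zP N.
  exact: le_lt_trans (lz N) Ne.
pose n := (Num.trunc (rnorm x)).+1.
have [_ _ _ _ /(_ l)] := fP (n, z n) (zP n); apply; first exact: (zl n.+1).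
by exists x => //; rewrite ltW// truncnS_gt.
Qed.

End Lifting.

(** * Small scalar perturbations *)
Section Perturbation.
Context {R : realType} {X : completeNormedModType R[i]}.

Lemma iter_rnorm_bounded (T : {linear X -> X}) (b : R) n : 0 < b ->
  (forall x, rnorm (T x) <= b * rnorm x) ->
  forall x, rnorm (iter n T x) <= b ^+ n * rnorm x.
Proof.
move=> b0 Tb x; elim: n => [|n ih] /=; first by rewrite mul1r.
by apply: le_trans (Tb _) _; rewrite exprS -mulrA ler_pM2l.
Qed.

Lemma norm_closed_preimage (f : X -> X) (b : R) (A : set X) : 0 < b ->
  (forall x y, rnorm (f x - f y) <= b * rnorm (x - y)) ->
  norm_closed A -> norm_closed (f @^-1` A).
Proof.
move=> b0 fb cA x xA; apply: cA => e e0.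
have [|y Ay xy] := xA (e / b); first exact: divr_gt0.
exists (f y) => //; apply: le_lt_trans (fb _ _) _.
by rewrite mulrC -ltr_pdivlMr.
Qed.

Variables (S : {linear X -> X}) (b : R) (d : nat).
Hypotheses (b0 : 0 < b) (Sb : forall x, rnorm (S x) <= b * rnorm x).
Implicit Types nu mu : R[i].

Let K := ker_iter S d.
Let sK : linsubspace K := linsubspace_ker_iter S d.

Lemma norm_closed_ker_iter : norm_closed K.
Proof.
have -> : K = iter d S @^-1` [set 0] by [].
apply: (@norm_closed_preimage _ (b ^+ d)); first exact: exprn_gt0.
  by move=> x y; rewrite -iter_linearB; exact: iter_rnorm_bounded.
move=> x x0; apply/eqP; rewrite -rnorm_eq0 eq_le rnorm_ge0 andbT.
by apply/ler_addgt0Pr => e /x0[_ ->]; rewrite subr0 add0r => /ltW.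
Qed.

Let cK := norm_closed_ker_iter.

Lemma sub_scalar_bounded nu x :
  rnorm (sub_scalar S nu x) <= (b + modulus nu) * rnorm x.
Proof.
rewrite sub_scalarE mulrDl; apply: le_trans (rnormB _ _) _.
by rewrite rnormZ lerD2r.
Qed.

Lemma shift_bound_gt0 nu : 0 < b + modulus nu.
Proof. by rewrite ltr_pwDl// modulus_ge0. Qed.

Lemma norm_closed_shift_ker nu : norm_closed (shift_ker S d nu).
Proof.
apply: (@norm_closed_preimage (sub_scalar S nu) (b + modulus nu)) cK.
  exact: shift_bound_gt0.
by move=> x y; rewrite -linearB; exact: sub_scalar_bounded.
Qed.

Definition shift_lifts c nu := lifts_with (sub_scalar S nu) K c.

Variable c : R.
Hypotheses (c0 : 0 < c) (lift0 : shift_lifts c 0).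
Hypothesis k0 : forall n, (d <= n)%N -> k_ S n = 0%E.

(** Choose x_(n+1) with S x_(n+1) = x_n modulo K and |x_(n+1)| <= c |x_n|; this
goes on for ever because x_n lies in some N(S^m), which is contained in P(0).
The sum of the nu^n x_n is the required vector, as (S - nu) telescopes. *)
Lemma shift_ker0_close nu x0 : c * modulus nu <= 2^-1 -> shift_ker S d 0 x0 ->
  exists2 x, shift_ker S d nu x &
    rnorm (x - x0) <= 2 * (c * modulus nu) * rnorm x0.
Proof.
move=> cnu Vx0.
pose G x := exists2 m, (d <= m)%N & ker_iter S m x.
have /choice[f fP] x : exists y, G x ->
    [/\ G y, K (x - S y) & rnorm y <= c * rnorm x].
  have [[m dm Sx]|nG] := pselect (G x); last by exists 0.
  have [y [Ky yx]] := lift0 (ker_iter_sub_shift_range0 k0 dm Sx).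
  exists y => _; split=> //; last by rewrite sub_scalar0 in Ky.
  exists m.+1; first exact: leqW.
  rewrite /ker_iter /mkset iterSr.
  have -> : S y = x - (x - S y) by rewrite opprB addrC subrK.
  rewrite sub_scalar0 in Ky; rewrite iter_linearB Sx -(subnK dm) iterD.
  by rewrite (Ky : iter d S _ = 0) iter_linear0 subrr.
pose x n := iter n f x0.
have Gx n : G (x n).
  elim: n => [|n ih]; last by have [] := fP _ ih.
  exists d.+1 => //; move: Vx0.
  by rewrite /shift_ker /ker_iter /mkset sub_scalar0 -iterSr.
have cnu0 : 0 <= c * modulus nu by rewrite mulr_ge0 ?modulus_ge0 ?(ltW c0).
have xn n : modulus nu ^+ n * rnorm (x n) <= (c * modulus nu) ^+ n * rnorm x0.
  elim: n => [//|n ih]; have [_ _ fn] := fP _ (Gx n).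
  apply: (@le_trans _ _ (modulus nu ^+ n.+1 * (c * rnorm (x n)))).
    by rewrite ler_wpM2l// exprn_ge0// modulus_ge0.
  have -> : modulus nu ^+ n.+1 * (c * rnorm (x n)) =
      c * modulus nu * (modulus nu ^+ n * rnorm (x n)) by rewrite exprS; ring.
  by rewrite [(c * _) ^+ _]exprS -[leRHS]mulrA ler_wpM2l.
have cn n : (c * modulus nu) ^+ n <= 2^-1 ^+ n by rewrite lerXn2r ?nnegrE.
pose s n := x0 + \sum_(i < n) nu ^+ i.+1 *: x i.+1.
have sS n : s n.+1 = s n + nu ^+ n.+1 *: x n.+1 by rewrite /s big_ord_recr addrA.
have mX n : modulus (nu ^+ n) = modulus nu ^+ n.
  elim: n => [|n ih]; first by rewrite /modulus normr1.
  by rewrite !exprS modulusM ih.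
have Ks n : K (nu ^+ n.+1 *: x n + sub_scalar S nu (s n)).
  elim: n => [|n ih].
    rewrite /s big_ord0 addr0 sub_scalarE addrC subrK -sub_scalar0; exact: Vx0.
  have -> : nu ^+ n.+2 *: x n.+1 + sub_scalar S nu (s n.+1) =
     (nu ^+ n.+1 *: x n + sub_scalar S nu (s n)) - nu ^+ n.+1 *: (x n - S (x n.+1)).
    rewrite sS linearD [sub_scalar S nu (_ *: _)]sub_scalarE linearZ.
    rewrite scalerA -exprS scalerBr opprB addrCA [_ + (_ - nu ^+ n.+2 *: _)]addrC subrK.
    rewrite [nu ^+ n.+1 *: x n + _]addrC -[RHS]addrA.
    by rewrite [_ + (_ - nu ^+ n.+1 *: x n)]addrC subrK.
  by apply: linsubspaceB => //; apply: linsubspaceZ => //; have [] := fP _ (Gx n).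
have [||l ls] := @geometric_limit R X s (c * modulus nu * rnorm x0).
- by rewrite mulr_ge0 ?rnorm_ge0.
- move=> n; rewrite sS opprD addrA subrr sub0r rnormN rnormZ mX.
  apply: le_trans (xn _) _; rewrite exprS -!mulrA mulrCA [leRHS]mulrCA !mulrA.
  rewrite -!mulrA !ler_wpM2l ?(ltW c0) ?modulus_ge0//.
  by rewrite mulrC ler_wpM2l ?rnorm_ge0.
exists l; last by have := ls 0%N; rewrite /s big_ord0 addr0 mulr1 !mulrA.
rewrite /shift_ker /mkset -[sub_scalar _ _ _]opprK; apply: linsubspaceN => //.
rewrite -sub0r.
apply: (@range_mod_limit _ _ _ _ _ (shift_bound_gt0 nu) (sub_scalar_bounded nu) cK 0 l
   (fun n => - (nu ^+ n.+1 *: x n)) s (modulus nu * rnorm x0)) _ _ ls => n.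
  by rewrite -opprD; exact: linsubspaceN.
rewrite sub0r opprK rnormZ mX exprS -!mulrA ler_wpM2l ?modulus_ge0//.
by apply: le_trans (xn n) _; rewrite mulrC ler_wpM2l ?rnorm_ge0.
Qed.

(** Given y = (S - nu) x1 modulo K, take x to be x1 minus an almost nearest
point of V(nu). Lifting y + nu x through S gives x', and x - x' lies in V(0),
so it is close to V(nu); therefore |x| is at most about 2 |x'|, while
|x'| <= c (|y| + |nu| |x|), whose last term is absorbed by |x|. *)
Lemma shift_lifts_uniform nu : c * modulus nu <= 32^-1 -> shift_lifts (8 * c) nu.
Proof.
move=> cnu y [x1 Kx1].
have sV := linsubspace_shift_ker S d nu.
have [|a Va amin] := almost_nearest x1 (@norm_closed_shift_ker nu).
  by exists 0; case: sV.
pose x := x1 - a.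
have Kx : K (y - sub_scalar S nu x).
  rewrite (linearB (sub_scalar S nu)) opprB addrCA addrC.
  exact: linsubspaceD.
have xmin z : shift_ker S d nu z -> rnorm x <= 2 * rnorm (x - z).
  by move=> Vz; rewrite /x -addrA -opprD; apply: amin; exact: linsubspaceD.
have [|x' [Kx' x'n]] := lift0 (y := y + nu *: x).
  by exists x; rewrite sub_scalar0 -addrA -[nu *: x - _]opprB; exact: Kx.
have Vd : shift_ker S d 0 (x - x').
  rewrite /shift_ker /mkset (linearB (sub_scalar S 0)).
  have -> : sub_scalar S 0 x - sub_scalar S 0 x' =
      (y + nu *: x - sub_scalar S 0 x') - (y - sub_scalar S nu x).
    rewrite [sub_scalar S 0 x]sub_scalar0 [sub_scalar S nu x]sub_scalarE.
    move: (sub_scalar S 0 x') => v; rewrite opprB [RHS]addrC.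
    have -> : S x - nu *: x - y = S x - (y + nu *: x).
      by rewrite -addrA -opprD [_ + y]addrC.
    by rewrite subrKA.
  exact: linsubspaceB.
have [|z Vz zn] := shift_ker0_close _ Vd (nu := nu); first by move: cnu; lra.
have {}zn : rnorm (x - x' - z) <= 16^-1 * (rnorm x + rnorm x').
  rewrite rnormC; apply: le_trans zn _.
  apply: ler_pM; rewrite ?rnorm_ge0 ?rnormB//.
    by rewrite !mulr_ge0 ?modulus_ge0 ?(ltW c0).
  by move: cnu; lra.
exists x; split=> //.
have h1 : rnorm (x - z) <= rnorm (x - x' - z) + rnorm x'.
  by rewrite -[x - z](subrK x') [x - z - x']addrAC; exact: rnormD.
have h2 := xmin z Vz.
have h3 : c * rnorm (y + nu *: x) <= c * rnorm y + 32^-1 * rnorm x.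
  apply: (@le_trans _ _ (c * (rnorm y + modulus nu * rnorm x))).
    by rewrite ler_pM2l// -rnormZ rnormD.
  by rewrite mulrDr lerD2l mulrA ler_wpM2r ?rnorm_ge0.
have := rnorm_ge0 x; have : 0 <= c * rnorm y by rewrite mulr_ge0 ?rnorm_ge0 ?(ltW c0).
rewrite -mulrA; move: h1 h2 h3 zn x'n; lra.
Qed.

Section Disc.
Variable e : R.
Hypothesis ce : c * e <= 32^-1.

Lemma disc_lifts nu : modulus nu <= e -> shift_lifts (8 * c) nu.
Proof.
by move=> nue; apply: shift_lifts_uniform; apply: le_trans ce; rewrite ler_pM2l.
Qed.

Let c8 : 0 < 8 * c. Proof. by rewrite mulr_gt0. Qed.

Lemma norm_closed_shift_range nu : modulus nu <= e -> norm_closed (shift_range S d nu).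
Proof.
move=> /disc_lifts l; apply: (lifts_norm_closed _ _ sK cK c8 l).
  exact: (shift_bound_gt0 nu).
exact: sub_scalar_bounded.
Qed.

Lemma shift_range_close nu mu : modulus nu <= e ->
  close_within (8 * c * modulus (nu - mu)) (shift_range S d nu) (shift_range S d mu).
Proof.
move=> /disc_lifts l y /l[x [Kx xy]].
exists (y - (mu - nu) *: x).
  exists x; have -> : y - (mu - nu) *: x - sub_scalar S mu x = y - sub_scalar S nu x.
    by rewrite (sub_scalar_shift S) opprB addrA addrAC addrK.
  exact: Kx.
rewrite subKr rnormZ modulusB [_ * modulus _]mulrC -mulrA.
by rewrite ler_wpM2l ?modulus_ge0.
Qed.

Lemma shift_ker_close nu mu : modulus mu <= e ->
  close_within (8 * c * modulus (nu - mu)) (shift_ker S d nu) (shift_ker S d mu).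
Proof.
move=> /disc_lifts l x Vx; have [<-|nm] := eqVneq nu mu.
  by exists x => //; rewrite !subrr rnorm0 modulus0 mulr0 mul0r.
have [z [Kz zx]] := l _ (shift_ker_sub_range nm Vx).
exists (x - (nu - mu) *: z); last first.
  rewrite subKr rnormZ [8 * c * _]mulrC -mulrA.
  by rewrite ler_wpM2l ?modulus_ge0.
rewrite /shift_ker /mkset.
have -> : sub_scalar S mu (x - (nu - mu) *: z) =
   sub_scalar S nu x + (nu - mu) *: (x - sub_scalar S mu z).
  rewrite scalerBr [(nu - mu) *: x](sub_scalar_shift S) addrA.
  rewrite [sub_scalar S nu x + _]addrC subrK (linearB (sub_scalar S mu)).
  by rewrite [sub_scalar S mu (_ *: _)]linearZ.
by apply: linsubspaceD => //; exact: linsubspaceZ.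
Qed.

(** A segment of the disc is covered by finitely many steps of length r. *)
Lemma disc_chain (Phi : R[i] -> Prop) (r : R) : 0 < r ->
    (forall nu mu, modulus nu <= e -> modulus mu <= e ->
       modulus (nu - mu) <= r -> Phi nu -> Phi mu) ->
  forall nu, modulus nu <= e -> Phi nu <-> Phi 0.
Proof.
move=> r0 step nu nue.
pose N := (Num.trunc (modulus nu / r)).+1.
pose p (j : nat) : R[i] := (j%:R / N%:R : R)%:C * nu.
have pe j : (j <= N)%N -> modulus (p j) <= e.
  move=> jN; rewrite modulusM modulus_real ?divr_ge0//.
  apply: le_trans nue; rewrite ler_piMl ?modulus_ge0//.
  by rewrite ler_pdivrMr// mul1r ler_nat.
have pp j : modulus (p j - p j.+1) <= r.
  have -> : p j - p j.+1 = - ((N%:R^-1)%:C * nu).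
    rewrite -mulrBl -rmorphB /= -mulrBl -natr1 opprD addrA subrr sub0r mulN1r.
    by rewrite rmorphN mulNr.
  rewrite modulusN modulusM modulus_real ?invr_ge0// ler_pdivrMl//.
  by rewrite -ler_pdivrMr// ltW// truncnS_gt.
have chain j : (j <= N)%N -> Phi (p j) <-> Phi 0.
  elim: j => [_|j ih jN]; first by rewrite /p mul0r mul0r.
  rewrite -(ih (ltnW jN)); split; apply: step; rewrite ?pe// 1?ltnW//.
  by rewrite modulusB.
by rewrite -(chain N (leqnn N)) /p divff ?mul1r// pnatr_eq0.
Qed.

Lemma quotdim_shift_range nu : modulus nu <= e ->
  quotdim setT (shift_range S d nu) = quotdim setT (shift_range S d 0).
Proof.
move=> nue.
have h n : has_free setT (shift_range S d nu) n <-> has_free setT (shift_range S d 0) n.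
  have [r r0 rP] := @codim_gap_lemma R X n.
  apply: (@disc_chain (fun nu => has_free setT (shift_range S d nu) n) (r / (8 * c))).
  - exact: divr_gt0.
  - move=> {nue}nu mu nue mue nmr; apply: rP.
    + exact: linsubspace_shift_range.
    + exact: norm_closed_shift_range.
    + move=> y /(shift_range_close nu mue)[z Pz yz]; exists z => //.
      apply: le_trans yz _; rewrite ler_wpM2r ?rnorm_ge0//.
      by rewrite modulusB mulrC -ler_pdivlMr.
  - exact: nue.
by apply/le_anti/andP; split; apply: quotdim_le => n /h.
Qed.

Lemma quotdim_shift_ker nu : modulus nu <= e ->
  quotdim (shift_ker S d nu) K = quotdim (shift_ker S d 0) K.
Proof.
move=> nue.
have h n : has_free (shift_ker S d nu) K n <-> has_free (shift_ker S d 0) K n.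
  have [r r0 rP] := @gap_lemma R X n.
  apply: (@disc_chain (fun nu => has_free (shift_ker S d nu) K n) (r / (8 * c))).
  - exact: divr_gt0.
  - move=> {nue}nu mu nue mue nmr; apply: rP => //.
    + exact: linsubspace_shift_ker.
    + exact: ker_iter_sub_shift_ker.
    + move=> y /(shift_ker_close mue)[z Pz yz]; exists z => //.
      apply: le_trans yz _; rewrite ler_wpM2r ?rnorm_ge0//.
      by rewrite mulrC -ler_pdivlMr.
  - exact: nue.
by apply/le_anti/andP; split; apply: quotdim_le => n /h.
Qed.

(** For mu <> nu the operator S - nu is a nonzero scalar on V(mu) modulo K, so
V(mu) lies in R((S - nu)^j) for each j. Letting mu tend to nu, V(nu) lies in
the closure of R((S - nu)^j). That range is closed by induction: if V(nu) is
contained in the closed subspace R((S - nu)^j), then small vectors of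
R((S - nu)^(j+1)) have small preimages, and limits can be lifted. *)
Lemma shift_semi_regular nu j : nu != 0 -> modulus nu <= e ->
  shift_ker S d nu `<=` range_iter (sub_scalar S nu) j.
Proof.
move=> nu0 nue.
set B := sub_scalar S nu.
have sR := linsubspace_range_iter B.
have sub_of_closed i : norm_closed (range_iter B i) -> shift_ker S d nu `<=` range_iter B i.
  move=> cR x Vx; apply: cR => h h0.
  (* mu = (1 - t) nu stays in the disc and differs from nu by t nu *)
  pose A : R := 8 * c * modulus nu * rnorm x.
  have A0 : 0 <= A by rewrite !mulr_ge0 ?modulus_ge0 ?rnorm_ge0 ?(ltW c0).
  have A1 : 0 < 1 + A by rewrite ltr_pwDl.
  pose t : R := Num.min 1 (h / (1 + A)).
  have t0 : 0 < t by rewrite lt_min ltr01 divr_gt0.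
  have t1 : t <= 1 by rewrite ge_min lexx.
  have tA : t * A < h.
    apply: (@lt_le_trans _ _ (t * (1 + A))); first by rewrite ltr_pM2l// ltrDr.
    by rewrite -ler_pdivlMr// ge_min lexx orbT.
  pose mu : R[i] := (1 - t)%:C * nu.
  have numu : nu - mu = t%:C * nu.
    by rewrite -[X in X - _]mul1r -mulrBl -[1]/(1%:C) -rmorphB /= subKr.
  have mue : modulus mu <= e.
    rewrite modulusM modulus_real ?subr_ge0//; apply: le_trans nue.
    by rewrite ler_piMl ?modulus_ge0// gerBl ltW.
  have mn : mu != nu.
    rewrite eq_sym -subr_eq0 numu mulf_neq0// (inj_eq (@complexI R) t 0).
    by rewrite gt_eqF.
  have [y Vy xy] := shift_ker_close mue Vx; exists y.
    exact: shift_ker_sub_range_iter mn nu0 _ Vy.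
  apply: le_lt_trans xy _; rewrite numu modulusM modulus_real ?(ltW t0)//.
  by move: tA; rewrite /A !mulrA [t * 8 * _]mulrAC; congr (_ < _); ring.
suff : norm_closed (range_iter B j) by exact: sub_of_closed.
elim: j => [|j ih]; first by rewrite range_iter0.
have VR := sub_of_closed _ ih.
move=> y yR.
have [x Bx] : exists x, B x = y.
  have : shift_range S d nu y.
    apply: norm_closed_shift_range => // h /yR[z Rz yz]; exists z => //.
    by move: Rz; rewrite range_iterS => -[w _ <-]; exact: sub_scalar_shift_range.
  by rewrite -shift_range_image// => -[x _ <-]; exists x.
rewrite range_iterS; exists x => //; apply: ih => h h0.
have [|z + yz] := yR (h / (8 * c)); first exact: divr_gt0.
rewrite range_iterS => -[w Rw Bw].
have [|u [Ku un]] := disc_lifts nue (y := y - z).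
  apply: linsubspaceB; first exact: linsubspace_shift_range.
    by rewrite -Bx; exact: sub_scalar_shift_range.
  by rewrite -Bw; exact: sub_scalar_shift_range.
exists (x - u).
  rewrite -(subrK w (x - u)); apply: linsubspaceD => //; apply: VR.
  rewrite /shift_ker /mkset -/B !(linearB B) Bx Bw addrAC; exact: Ku.
rewrite opprB addrC subrK; apply: le_lt_trans un _.
by rewrite mulrC -ltr_pdivlMr.
Qed.

End Disc.

End Perturbation.

(** * Lower semi-Weyl and lower semi-B-Weyl operators *)
Section Weyl.
Context {R : realType} {X : completeNormedModType R[i]}.
Implicit Types T : {linear X -> X}.

Lemma quotdim_sub0 (V W : set X) : V `<=` W -> quotdim V W = 0%E.
Proof.
move=> VW; apply: (@quotdim_eq _ _ V W 0); first exact: has_free0.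
move=> [v [Vv fv]]; have /(fv (fun=> 1)) /(_ ord0) /eqP : W (\sum_(i < 1) 1 *: v i).
  by rewrite big_ord1 scale1r; exact/VW/Vv.
by rewrite oner_eq0.
Qed.

Definition lower_weyl_on T n : Prop :=
  (defect T (range_iter T n) < +oo)%E /\ (0 <= fredholm_index T (range_iter T n))%E.

Lemma index_const T m n : (m <= n)%N -> (defect T (range_iter T m) < +oo)%E ->
  fredholm_index T (range_iter T m) = fredholm_index T (range_iter T n).
Proof.
move=> /subnKC <- fm; elim: (n - m)%N => [|k ih]; first by rewrite addn0.
rewrite ih addnS; apply: index_step; apply: le_lt_trans fm.
by apply: defect_le; exact: leq_addr.
Qed.

Lemma lower_weyl_on_le T m n : (m <= n)%N -> lower_weyl_on T m -> lower_weyl_on T n.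
Proof.
move=> mn [fm im]; split; first exact: le_lt_trans (defect_le T mn) fm.
by rewrite -(index_const mn).
Qed.

(** Where k_n vanishes, defects do not grow when n decreases, so finiteness
also passes downwards. *)
Lemma lower_weyl_on_ge T m n : (forall j, (m <= j)%N -> k_ T j = 0%E) ->
  (m <= n)%N -> lower_weyl_on T n -> lower_weyl_on T m.
Proof.
move=> k0 mn [fn im].
have dmn : defect T (range_iter T m) = defect T (range_iter T n).
  move: mn => /subnKC <-; elim: (n - m)%N => [|k ih]; first by rewrite addn0.
  by rewrite addnS ih defect_step k0 ?leq_addr// adde0.
by split; rewrite ?dmn// (index_const mn)// dmn.
Qed.

Lemma lower_weyl_on_uniform_descent T d n : (forall j, (d <= j)%N -> k_ T j = 0%E) ->
  lower_weyl_on T n -> lower_weyl_on T d.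
Proof.
move=> k0; have [nd|/ltnW dn] := leqP n d; first exact: lower_weyl_on_le.
exact: lower_weyl_on_ge.
Qed.

Lemma lower_semi_weylP T : lower_semi_weyl T setT <-> lower_weyl_on T 0.
Proof. by rewrite /lower_weyl_on range_iter0. Qed.

(** By [index_const] the indices collected in [b_index] all agree, so the value
picked there is the index at any admissible degree. *)
Lemma lower_semi_b_weylP T : lower_semi_b_weyl T <->
  exists2 n, closed (range_iter T n) & lower_weyl_on T n.
Proof.
have idx n : b_fredholm_degree T n -> b_index T = fredholm_index T (range_iter T n).
  move=> dn; rewrite /b_index; case: xgetP => [_ -> [m dm <-]|none]; last first.
    by case: (none (fredholm_index T (range_iter T n))); exists n.
  rewrite (index_const (leq_maxl m n)) ?(proj2 dm)//.
  by rewrite [RHS](index_const (leq_maxr m n)) ?(proj2 dn).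
split=> [[[n dn] i0]|[n cn [fn i0]]].
  by exists n; [case: dn|split; [case: dn|rewrite -idx]].
have dn : b_fredholm_degree T n by [].
by split; [exists n|rewrite (idx _ dn)].
Qed.

(* sub_scalar (sub_scalar T l) nu and sub_scalar T (l + nu) are equal as
   functions but are different terms as linear maps *)
Section Extensionality.
Variables T T' : {linear X -> X}.
Hypothesis TT' : T =1 T'.

Let E : (T : X -> X) = T' := funext TT'.

Lemma eq_range_iter n : range_iter T n = range_iter T' n.
Proof. by rewrite /range_iter E. Qed.

Lemma eq_lower_weyl_on n : lower_weyl_on T n <-> lower_weyl_on T' n.
Proof.
by rewrite /lower_weyl_on /fredholm_index /nullity /restr_ker /defect eq_range_iter E.
Qed.

Lemma eq_lower_semi_weyl : lower_semi_weyl T setT <-> lower_semi_weyl T' setT.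
Proof. by rewrite !lower_semi_weylP eq_lower_weyl_on. Qed.

Lemma eq_lower_semi_b_weyl : lower_semi_b_weyl T <-> lower_semi_b_weyl T'.
Proof.
rewrite !lower_semi_b_weylP.
by split=> -[n cn wn]; exists n; [rewrite -eq_range_iter|apply/eq_lower_weyl_on|
  rewrite eq_range_iter|apply/eq_lower_weyl_on].
Qed.

End Extensionality.

(** Through this description the closedness of P(0) follows from that of
R(T^(d+1)), either in X or in the finer range topology of R(T^d). *)
Lemma shift_range0E T d : shift_range T d 0 = iter d T @^-1` range_iter T d.+1.
Proof.
apply/seteqP; split=> x.
  move=> [z]; rewrite /ker_iter /mkset sub_scalar0 iter_linearB -iterSr => /eqP.
  by rewrite subr_eq0 => /eqP xz; exists z.
move=> [z _ xz]; exists z.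
by rewrite /ker_iter /mkset sub_scalar0 iter_linearB -iterSr xz subrr.
Qed.

Lemma range_norm_le T d x : range_norm T d (iter d T x) <= rnorm x.
Proof.
by apply: ge_inf; [exists 0 => _ [z _ <-]; exact: rnorm_ge0|exists x].
Qed.

Lemma range_closed_shift_range T d : range_closed T d (range_iter T d.+1) ->
  norm_closed (shift_range T d 0).
Proof.
rewrite shift_range0E => cR x xR; apply: cR; first by exists x.
move=> e /xR[y Ry xy]; exists (iter d T y) => //.
by rewrite -iter_linearB; apply: le_lt_trans xy; exact: range_norm_le.
Qed.

Lemma closed_shift_range T d (b : R) : 0 < b ->
  (forall x, rnorm (T x) <= b * rnorm x) ->
  closed (range_iter T d.+1) -> norm_closed (shift_range T d 0).
Proof.
move=> b0 Tb /closed_norm_closed cR; rewrite shift_range0E.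
apply: (norm_closed_preimage (b := b ^+ d)) cR; first exact: exprn_gt0.
by move=> x y; rewrite -iter_linearB; exact: iter_rnorm_bounded.
Qed.

End Weyl.

(** * The punctured disc and the spectra *)
Section Punctured.
Context {R : realType} {X : completeNormedModType R[i]}.

(** The two equivalences have the same right-hand side, which does not mention
nu. *)
Lemma punctured_disc (S : {linear X -> X}) (b : R) d : 0 < b ->
    (forall x, rnorm (S x) <= b * rnorm x) ->
    (forall n, (d <= n)%N -> k_ S n = 0%E) ->
    norm_closed (shift_range S d 0) ->
  exists2 e : R, 0 < e & forall nu : R[i], nu != 0 -> modulus nu <= e ->
    (lower_semi_weyl (sub_scalar S nu) setT <-> lower_weyl_on S d) /\
    (lower_semi_b_weyl (sub_scalar S nu) <-> lower_weyl_on S d).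
Proof.
move=> b0 Sb k0 cM.
have [c c0 lift0] := open_mapping (shift_bound_gt0 b0 0) (sub_scalar_bounded Sb 0)
  (linsubspace_ker_iter S d) (norm_closed_ker_iter b0 Sb (d := d)) cM.
have e0 : 0 < (32 * c)^-1 by rewrite invr_gt0 mulr_gt0.
have ce : c * (32 * c)^-1 <= 32^-1 by rewrite invfM mulrCA divff ?gt_eqF// mulr1.
exists (32 * c)^-1 => // nu nu0 nue.
have W : lower_semi_weyl (sub_scalar S nu) setT <-> lower_weyl_on S d.
  rewrite /lower_weyl_on /lower_semi_weyl /lower_semi_fredholm /fredholm_index.
  rewrite (defect_shift S d nu0) (nullity_shift S d nu0) defect_shift0 nullity_shift0.
  by rewrite (quotdim_shift_range b0 Sb c0 lift0 k0 ce nue)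
     (quotdim_shift_ker b0 Sb c0 lift0 k0 ce nue).
split=> //; rewrite -W lower_semi_weylP lower_semi_b_weylP.
split=> [[n _]|W0]; last first.
  by exists 0%N => //; rewrite range_iter0; exact: closedT.
apply: lower_weyl_on_uniform_descent => j _; apply: quotdim_sub0.
move=> x [Rx Nx]; split => //.
have Vx : shift_ker S d nu x.
  by rewrite /shift_ker /mkset (Nx : sub_scalar S nu x = 0); case: (linsubspace_ker_iter S d).
exact: (shift_semi_regular b0 Sb c0 lift0 k0 ce j.+1 nu0 nue Vx).
Qed.

End Punctured.

Section Spectrum.
Context {R : realType}.

Lemma nbhs_modulusP (l : R[i]^o) (U : set R[i]^o) : nbhs l U <->
  exists2 e : R, 0 < e & forall nu, modulus nu < e -> U (l + nu).
Proof.
split=> [/nbhs_ballP[e /= e0 eU]|[e e0 eU]].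
  have e0' : 0 < complex.Re e by move: e0; rewrite ltcE => /andP[].
  exists (complex.Re e) => // nu nue; apply: eU.
  rewrite -ball_normE /ball_ /= opprD addrA subrr sub0r normrN modulusE.
  by rewrite -(RRe_real (ger0_real (ltW e0))) ltcR.
apply/nbhs_ballP; exists e%:C; first by rewrite /= ltcR.
move=> y; rewrite -ball_normE /ball_ /= => ly.
rewrite -(subrK l y) addrC; apply: eU.
by rewrite -ltcR -modulusE distrC.
Qed.

(** Off its centre, membership in E is constant near l; the centre can only be
better than its surroundings if they are good as well. *)
Lemma limit_point_interior (E : set R[i]^o) (l : R[i]^o) (e : R) (good : Prop) : 0 < e ->
    (forall nu, nu != 0 -> modulus nu <= e -> ~ E (l + nu) <-> good) ->
    (~ E l -> good) ->
  (~ limit_point E l <-> good) /\ (~ interior E l <-> good).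
Proof.
move=> e0 punct center.
have small (h : R) : 0 < h -> exists nu, [/\ nu != 0, modulus nu <= e & modulus nu < h].
  move=> h0; pose t := Num.min e (h / 2).
  have t0 : 0 < t by rewrite lt_min e0 divr_gt0.
  exists t%:C; rewrite modulus_real ?(ltW t0)//; split.
  - by rewrite (inj_eq (@complexI R) t 0) gt_eqF.
  - by rewrite ge_min lexx.
  - by rewrite gt_min ltr_pdivrMr// ltr_pMr// ltr1n orbT.
have bad nu : ~ good -> nu != 0 -> modulus nu <= e -> E (l + nu).
  by move=> ngood nu0 nue; apply: contrapT => /(punct _ nu0 nue).
split; split.
- move=> nlim; apply: contrapT => ngood; apply: nlim => U /nbhs_modulusP[h h0 hU].
  have [nu [nu0 nue nuh]] := small h h0; exists (l + nu); split.
  + by rewrite -subr_eq0 addrAC subrr add0r.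
  + exact: bad.
  + exact: hU.
- move=> gd lim; have [|y [yl Ey [nu nu0 nue]]] :=
      lim [set y | exists2 nu, modulus nu <= e & y = l + nu].
    by apply/nbhs_modulusP; exists e => // nu nue; exists nu => //; exact: ltW.
  have nz : nu != 0.
    by apply: contraNN yl => /eqP nz; rewrite nue nz addr0.
  by have /(_ gd) := (punct nu nz nu0).2; rewrite -nue.
- move=> nint; apply: contrapT => ngood; apply: nint; apply/nbhs_modulusP.
  exists e => // nu nue; have [->|nu0] := eqVneq nu 0; last exact/bad/ltW.
  by rewrite addr0; apply: contrapT => /center.
- move=> gd /nbhs_modulusP[h h0 hE]; have [nu [nu0 nue nuh]] := small h h0.
  by have /(_ gd) := (punct nu nu0 nue).2; apply; exact: hE.
Qed.

End Spectrum.

Section Equivalences.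
Context {R : realType} {X : completeNormedModType R[i]}.

Lemma spectra_near (T : {linear X -> X}) (l : R[i]) (d : nat) (b : R) :
    let S := sub_scalar T l in 0 < b ->
    (forall x, rnorm (S x) <= b * rnorm x) ->
    (forall n, (d <= n)%N -> k_ S n = 0%E) ->
    norm_closed (shift_range S d 0) ->
  [/\ ~ limit_point (lower_semi_weyl_spectrum T) l <-> lower_weyl_on S d,
      ~ interior (lower_semi_weyl_spectrum T) l <-> lower_weyl_on S d,
      ~ limit_point (lower_semi_b_weyl_spectrum T) l <-> lower_weyl_on S d &
      ~ interior (lower_semi_b_weyl_spectrum T) l <-> lower_weyl_on S d].
Proof.
move=> S b0 Sb k0 cM.
have [e e0 punct] := punctured_disc b0 Sb k0 cM.
have Snu nu : sub_scalar S nu =1 sub_scalar T (l + nu).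
  by move=> x; rewrite !sub_scalarE scalerDl opprD addrA.
have [||H1 H2] := @limit_point_interior R (lower_semi_weyl_spectrum T) l e
    (lower_weyl_on S d) e0.
- move=> nu nu0 nue; rewrite -(punct nu nu0 nue).1 (eq_lower_semi_weyl (Snu nu)).
  exact: not_notP.
- move=> /contrapT /lower_semi_weylP; exact: lower_weyl_on_uniform_descent.
have [||H3 H4] := @limit_point_interior R (lower_semi_b_weyl_spectrum T) l e
    (lower_weyl_on S d) e0; last by split.
- move=> nu nu0 nue; rewrite -(punct nu nu0 nue).2 (eq_lower_semi_b_weyl (Snu nu)).
  exact: not_notP.
- move=> /contrapT /lower_semi_b_weylP[n _]; exact: lower_weyl_on_uniform_descent.
Qed.

End Equivalences.

Theorem theorem2p4 (R : realType) (X : completeNormedModType R[i])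
    (lambda : R[i]) (T : {linear X -> X}) (d : nat)
    (X_infinite_dim : subdim [set: X] = +oo%E)
    (T_bounded : continuous T) :
  (top_uniform_descent (sub_scalar T lambda) d ->
    [<-> ~ limit_point (lower_semi_weyl_spectrum T) lambda;
         ~ interior (lower_semi_weyl_spectrum T) lambda;
         ~ limit_point (lower_semi_b_weyl_spectrum T) lambda;
         ~ interior (lower_semi_b_weyl_spectrum T) lambda]) /\
  (quasi_fredholm (sub_scalar T lambda) ->
    [<-> ~ limit_point (lower_semi_weyl_spectrum T) lambda;
         ~ interior (lower_semi_weyl_spectrum T) lambda;
         ~ limit_point (lower_semi_b_weyl_spectrum T) lambda;
         ~ interior (lower_semi_b_weyl_spectrum T) lambda;
         lower_semi_b_weyl (sub_scalar T lambda)]).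
Proof.
have [b b0 Tb] := continuous_rnorm_bounded T_bounded.
have Sb := sub_scalar_bounded Tb lambda.
have b0' := shift_bound_gt0 b0 lambda.
split=> [[k0 cR]|[m [k0 cR]]].
  have cM := range_closed_shift_range (cR d.+1 (leqnSn d)).
  have [H1 H2 H3 H4] := spectra_near b0' Sb k0 cM.
  tfae; by rewrite ?H1 ?H2 ?H3 ?H4.
have cM := closed_shift_range b0' Sb cR.
have [H1 H2 H3 H4] := spectra_near b0' Sb k0 cM.
have H5 : lower_semi_b_weyl (sub_scalar T lambda) <->
    lower_weyl_on (sub_scalar T lambda) m.
  rewrite lower_semi_b_weylP; split=> [[n _]|W].
    exact: lower_weyl_on_uniform_descent.
  by exists m.+1 => //; exact: lower_weyl_on_le W.
by tfae; rewrite ?H1 ?H2 ?H3 ?H4 ?H5.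
Qed.
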